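(* Let $p\in(0,\infty)$ and let $\phi\in\mathrm{Cvx}(\mathbb{R}^n)$. There exists a unique point $s_p(\phi)\in\mathbb{R}^n$ such that $$\mathcal{M}_p(T_{s_p(\phi)}\phi)=\inf_{x\in\mathbb{R}^n}\mathcal{M}_p(T_x\phi).$$ This point is also the unique point such that $b\big((T_{s_p(\phi)}\phi)^{*,p}\big)=0$. Moreover, $s_p(\phi)\in\mathrm{int}\,\{\phi<\infty\}$.
   Context: For $f:\mathbb{R}^n\to\mathbb{R}\cup\{\infty\}$ let $V(f)=\int_{\mathbb{R}^n}e^{-f(x)}\,dx$ (with $e^{-\infty}=0$). $\mathrm{Cvx}(\mathbb{R}^n)$ is the set of proper, convex, lower semi-continuous functions $\phi:\mathbb{R}^n\to\mathbb{R}\cup\{\infty\}$ with $0<V(\phi)<\infty$. For $p\in(0,\infty)$ and $f$ with $0<V(f)<\infty$, the $L^p$-Legendre transform is $$f^{*,p}(y)=\frac1p\log\int_{\mathbb{R}^n}e^{p(\langle x,y\rangle-f(x))}\frac{e^{-f(x)}\,dx}{V(f)},$$ which may take the value $\infty$, and the $L^p$-Mahler integral is $\mathcal{M}_p(f)=V(f)V(f^{*,p})\in[0,\infty]$. Translation: $(T_af)(x)=f(x+a)$. For a measurable $f$ with $0<V(f)<\infty$, the barycenter is $b(f)=\int_{\mathbb{R}^n}x\,\frac{e^{-f(x)}dx}{V(f)}\in\mathbb{R}^n$ (whenever defined; in particular the condition $b((T_x\phi)^{*,p})=0$ presupposes $0<V((T_x\phi)^{*,p})<\infty$). $\{\phi<\infty\}=\{x\in\mathbb{R}^n:\phi(x)<\infty\}$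 and $\mathrm{int}$ denotes interior. *)

(* Defs.v *)
From HB Require Import structures.
From mathcomp Require Import all_boot all_order all_algebra.
From mathcomp Require Import all_classical all_reals all_analysis.
From mathcomp Require Import measurable_realfun.

Set Implicit Arguments.
Unset Strict Implicit.
Unset Printing Implicit Defensive.

Import Order.TTheory GRing.Theory Num.Theory.
Import numFieldNormedType.Exports.

Local Open Scope classical_set_scope.
Local Open Scope ring_scope.

(* R^n is 'rV[R]_n, with the library's topology and the sigma-algebra generated
   by the n coordinates, i.e. the Borel sigma-algebra (as the library does for
   n.-tuple R). *)
Definition rV_display : measure_display -> measure_display.
Proof. exact. Qed.

Section measurable_rV.
Context {R : realType} {n : nat}.

Let coors : 'I_n -> 'rV[R]_n -> R := fun i x => x ord0 i.

Let rV_set0 : g_sigma_preimage coors set0.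
Proof. exact: sigma_algebra0. Qed.

Let rV_setC A : g_sigma_preimage coors A -> g_sigma_preimage coors (~` A).
Proof. exact: sigma_algebraC. Qed.

Let rV_bigcup (F : (set 'rV[R]_n)^nat) :
  (forall i, g_sigma_preimage coors (F i)) ->
  g_sigma_preimage coors (\bigcup_i (F i)).
Proof. exact: sigma_algebra_bigcup. Qed.

HB.instance Definition _ := @isMeasurable.Build
  (rV_display default_measure_display)
  'rV[R]_n (g_sigma_preimage coors) rV_set0 rV_setC rV_bigcup.

End measurable_rV.

Lemma measurable_coord_rV (R : realType) n (i : 'I_n) :
  measurable_fun [set: 'rV[R]_n] (fun x : 'rV[R]_n => x ord0 i).
Proof.
move=> _ Y mY; rewrite setTI; apply: sub_sigma_algebra => /=.
rewrite -bigcup_seq/=; exists i => /=; first by rewrite mem_index_enum.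
by exists Y => //; rewrite setTI.
Qed.

Lemma measurable_fun_rVP d (T : measurableType d) (R : realType) n
    (f : T -> 'rV[R]_n) :
  measurable_fun [set: T] f <->
  forall i, measurable_fun [set: T] (fun t => f t ord0 i).
Proof.
split=> [mf i|mf].
  exact: (measurableT_comp (@measurable_coord_rV R n i) mf).
pose F := [set A : set 'rV[R]_n | measurable (f @^-1` A)].
suff H : (@measurable _ 'rV[R]_n) `<=` F.
  by move=> _ A mA; rewrite setTI; exact: H.
apply: smallest_sub; first split => //=.
- by rewrite /F/= preimage_set0.
- by move=> A FA; rewrite /F/= setTD preimage_setC; exact: measurableC.
- by move=> A FA; rewrite /F/= preimage_bigcup; exact: bigcupT_measurable.
- rewrite -bigcup_seq/=; apply: bigcup_sub => i _ _ [B mB <-].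
  by rewrite setTI /F/= -[X in measurable X]setTI; exact: (mf i).
Qed.

Section lebesgue_rV.
Context {R : realType}.

Definition cons_rV n (z : measurableTypeR R * 'rV[R]_n) : 'rV[R]_n.+1 :=
  row_mx (z.1)%:M z.2.

Definition uncons_rV n (x : 'rV[R]_n.+1) : measurableTypeR R * 'rV[R]_n :=
  (x ord0 ord0, @rsubmx _ 1 1 n x).

Lemma cons_rVK n : cancel (@cons_rV n) (@uncons_rV n).
Proof.
move=> [a x]; rewrite /uncons_rV /cons_rV row_mxKr; congr pair => /=.
rewrite [RHS](_ : a = (a%:M : 'M[R]_1) ord0 ord0); last by rewrite mxE eqxx.
rewrite -(@row_mxEl _ 1 1 n a%:M x).
by congr (fun_of_matrix _ _ _); exact/val_inj.
Qed.

Lemma uncons_rVK n : cancel (@uncons_rV n) (@cons_rV n).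
Proof.
move=> x; rewrite /uncons_rV /cons_rV/= -[RHS](@hsubmxK _ 1 1 n).
suff -> : (x ord0 ord0)%:M = @lsubmx _ 1 1 n x by [].
by rewrite [RHS]mx11_scalar mxE; congr (fun_of_matrix _ _ _)%:M; exact/val_inj.
Qed.

Lemma measurable_cons_rV n : measurable_fun setT (@cons_rV n).
Proof.
apply/measurable_fun_rVP => i; rewrite /cons_rV.
have [j ->|j ->] := @split_ordP 1 n i.
- rewrite (_ : (fun _ => _) = fst); first exact: measurable_fst.
  by apply/funext => z; apply: etrans (row_mxEl _ _ _ _) _;
    rewrite mxE (ord1 j).
- rewrite (_ : (fun _ => _) = (fun x : 'rV[R]_n => x ord0 j) \o snd).
    by apply: measurableT_comp;
      [exact: measurable_coord_rV|exact: measurable_snd].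
  by apply/funext => z; exact: row_mxEr.
Qed.

Lemma measurable_uncons_rV n : measurable_fun setT (@uncons_rV n).
Proof.
apply/measurable_fun_pair; first exact: measurable_coord_rV.
apply/measurable_fun_rVP => i /=.
rewrite (_ : (fun _ => _) = fun x : 'rV[R]_n.+1 => x ord0 (rshift 1 i)).
  exact: measurable_coord_rV.
by apply/funext => z; rewrite mxE.
Qed.

HB.instance Definition _ n :=
  isMeasurableFun.Build _ _ _ _ (@cons_rV n) (@measurable_cons_rV n).

Section lebesgueS_rV.
Context {n : nat} (mu : {sigma_finite_measure set 'rV[R]_n -> \bar R}).

Definition lebesgueS_rV : set 'rV[R]_n.+1 -> \bar R :=
  pushforward (@lebesgue_measure R \x mu)%E (@cons_rV n).

Let lebesgueS0 : lebesgueS_rV set0 = 0%E.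
Proof. exact: measure0. Qed.

Let lebesgueS_ge0 A : (0 <= lebesgueS_rV A)%E.
Proof. exact: measure_ge0. Qed.

Let lebesgueS_sigma_additive : semi_sigma_additive lebesgueS_rV.
Proof. exact: measure_semi_sigma_additive. Qed.

HB.instance Definition _ := isMeasure.Build _ _ _ lebesgueS_rV
  lebesgueS0 lebesgueS_ge0 lebesgueS_sigma_additive.

Let lebesgueS_sigma_finite : sigma_finite setT lebesgueS_rV.
Proof.
have /sigma_finiteP[F [FT ndF Foo]] := sigma_finiteT (@lebesgue_measure R).
have /sigma_finiteP[G [GT ndG Goo]] := sigma_finiteT mu.
exists (fun k => @uncons_rV n @^-1` (F k `*` G k)).
  rewrite -preimage_bigcup (_ : \bigcup_k (F k `*` G k) = setT) ?preimage_setT//.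
  rewrite -setXTT FT GT predeqE => -[x y]; split.
    by move=> [k _ [/= Fx Gy]]; split; exists k.
  move=> [/= [k _ Fx] [l _ Gy]]; exists (maxn k l) => //; split => /=.
  - by move: x Fx; exact/subsetPset/ndF/leq_maxl.
  - by move: y Gy; exact/subsetPset/ndG/leq_maxr.
move=> k; have [mF Fk] := Foo k; have [mG Gk] := Goo k; split.
  rewrite -[X in measurable X]setTI; apply: measurable_uncons_rV => //.
  exact: measurableX.
rewrite /lebesgueS_rV /pushforward (_ : _ @^-1` _ = F k `*` G k).
  by rewrite product_measure1E// lte_mul_pinfty// ge0_fin_numE.
by rewrite -comp_preimage (_ : _ \o _ = id)//; apply/funext; exact: cons_rVK.
Qed.

HB.instance Definition _ := Measure_isSigmaFinite.Build _ _ _ lebesgueS_rV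
  lebesgueS_sigma_finite.

End lebesgueS_rV.

(* The Lebesgue measure on R^n, as the n-fold product of the one-dimensional
   one; see lebesgue_rV_box. *)
Fixpoint lebesgue_rV n : {sigma_finite_measure set 'rV[R]_n -> \bar R} :=
  if n is m.+1 then lebesgueS_rV (lebesgue_rV m) else \d_(0 : 'rV[R]_0).

Lemma lebesgue_rV_box n (A : 'I_n -> set (measurableTypeR R)) :
  (forall i, measurable (A i)) ->
  lebesgue_rV n [set x : 'rV[R]_n | forall i, A i (x ord0 i)] =
  (\prod_(i < n) lebesgue_measure (A i))%E.
Proof.
elim: n A => [|n ih] A mA.
  rewrite big_ord0 /= diracE mem_set//=; by case.
rewrite big_ord_recl -ih// /= /lebesgueS_rV /pushforward.
rewrite -product_measure1E//.
  congr (product_measure1 _ _ _); apply/seteqP; split=> -[a x] /=.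
    move=> Ax; split.
      have := Ax ord0.
      by have -> : cons_rV (a, x) ord0 ord0 = a := congr1 fst (cons_rVK (a, x)).
    move=> i; have := Ax (lift ord0 i); congr (A _ _).
    rewrite (_ : lift ord0 i = rshift 1 i); last exact/val_inj.
    exact: row_mxEr.
  move=> [Aa Ax] i; have [j ->|->] := unliftP ord0 i.
  - have := Ax j; congr (A _ _).
    rewrite (_ : lift ord0 j = rshift 1 j); last exact/val_inj.
    exact/esym/row_mxEr.
  - by have -> : cons_rV (a, x) ord0 ord0 = a := congr1 fst (cons_rVK (a, x)).
rewrite (_ : [set _ | _] =
    \bigcap_(i in [set: 'I_n])
      ((fun x : 'rV[R]_n => x ord0 i) @^-1` A (lift ord0 i))).
  apply: fin_bigcap_measurable; first exact: finite_finset.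
  move=> i _; rewrite -[X in measurable X]setTI.
  exact: (@measurable_coord_rV R n i measurableT _ (mA (lift ord0 i))).
by apply/seteqP; split=> x /= Ax i; [move=> _; exact: Ax|exact: (Ax i Logic.I)].
Qed.

End lebesgue_rV.

Section Lp_mahler.
Local Open Scope ereal_scope.
Context {R : realType} {n : nat}.
Implicit Types (f phi : 'rV[R]_n -> \bar R) (x y a : 'rV[R]_n) (p : R).

Definition dotp x y : R := (\sum_(i < n) x ord0 i * y ord0 i)%R.

(* V(f); expeR (-oo) = 0. *)
Definition vol f : \bar R := \int[lebesgue_rV n]_x expeR (- f x).

Definition proper_fun f : Prop :=
  (forall x, f x != -oo) /\ exists x, f x != +oo.

(* For f that never takes the value -oo, 0 * +oo = 0 makes the inequality
   trivial at t = 0 and t = 1. *)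
Definition convex_efun f : Prop :=
  forall x y (t : R), (0 <= t <= 1)%R ->
    f (t *: x + (1 - t) *: y)%R <= t%:E * f x + (1 - t)%:E * f y.

Definition Cvx phi : Prop :=
  [/\ proper_fun phi, convex_efun phi, lower_semicontinuous phi
    & 0 < vol phi < +oo].

(* f^{*,p}; lne +oo = +oo. *)
Definition Lp_legendre p f : 'rV[R]_n -> \bar R := fun y =>
  (p^-1)%:E * lne (\int[lebesgue_rV n]_x
    (expeR (p%:E * ((dotp x y)%:E - f x)) * (expeR (- f x) / vol f))).

Definition Lp_mahler p f : \bar R := vol f * vol (Lp_legendre p f).

Definition translate a f : 'rV[R]_n -> \bar R := fun x => f (x + a)%R.

(* b(f) is defined: x e^{-f(x)} / V(f) is absolutely integrable on R^n. *)
Definition has_barycenter f : Prop :=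
  [/\ measurable_fun [set: 'rV[R]_n] f, 0 < vol f < +oo
    & forall i, (lebesgue_rV n).-integrable setT
        (fun x => (x ord0 i)%:E * (expeR (- f x) / vol f))].

Definition barycenter f : 'rV[R]_n :=
  \row_i fine (\int[lebesgue_rV n]_x
    ((x ord0 i)%:E * (expeR (- f x) / vol f))).

End Lp_mahler.

(* Main.v *)
From HB Require Import structures.
Require Import Defs.
From mathcomp Require Import all_boot all_order all_algebra.
From mathcomp Require Import all_classical all_reals all_analysis.
From mathcomp Require Import measurable_realfun ring lra.

Set Implicit Arguments.
Unset Strict Implicit.
Unset Printing Implicit Defensive.

Import Order.TTheory GRing.Theory Num.Theory.
Import numFieldNormedType.Exports.

Local Open Scope classical_set_scope.
Local Open Scope ring_scope.

(** Write [V] for the volume of [phi], [L] for the [L^p]-Legendre transform of [phi]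
    and [w = exp (- L)].  Translating [phi] by [z] subtracts the linear function
    [dotp z] from [L], and [V] is translation invariant.  So, with
      [G z = \int exp (dotp z y) * w y dy],
    the Mahler integral of the [z]-translate of [phi] is [V * G z], and the
    barycenter of the transform of the [z]-translate is the mean of [y] for the
    density [exp (dotp z y) * w y], which is formally the gradient of [log G]
    at [z].  The theorem thus says that the Laplace transform [G] has exactly one
    minimizer, that it is the only critical point of [G], and that it lies in the
    interior of the domain of [phi].

    The function [w] is bounded below on a cube around 0 ([dual_weight_lower]),
    because a convex function with finite positive volume grows at least linearly
    ([convex_linear_growth]).  This makes [G] coercive and strictly convex where it is
    finite, so there is a minimizer ([laplace_minimizer_exists], by Fatou) and it is
    unique ([laplace_minimizer_unique]).  Convexity of the exponential gives that a
    critical point is a minimizer ([laplace_critical_minimizer]).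

    Everything else follows from the domain of [G], which is the interior of the domain
    of [phi].  At an interior point [z], [phi] is bounded on a cube around [z], so
    [exp (dotp z y) * w y] decays exponentially ([laplace_interior_lty]); then [G] is
    finite and may be differentiated under the integral
    ([laplace_minimizer_critical]).  At any other point there is a direction [th] with
    [dotp (x - z) th <= 0] on the domain of [phi] ([convex_supporting]), so
    [exp (dotp z y) * w y] does not decrease when [y] moves along [th], and a
    nonnegative function with this property and a positive lower bound on one cube has
    infinite integral ([laplace_not_interior]).

    Lower bounds of integrals all come from cubes: one cube, or [N] disjoint cubes in
    arithmetic progression ([le_integral_cubes]). *)

(** * Iterated integrals and translations *)

Section lebesgue_rV_theory.
Context {R : realType}.
Local Open Scope ereal_scope.

Lemma ge0_integral_cons_rV n (f : 'rV[R]_n.+1 -> \bar R) :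
  measurable_fun setT f -> (forall x, 0 <= f x) ->
  \int[lebesgue_rV n.+1]_x f x =
  \int[lebesgue_measure]_a \int[lebesgue_rV n]_x f (cons_rV (a, x)).
Proof.
move=> mf f0.
rewrite -(fubini_tonelli1 (fun z => f (cons_rV z)))//; last first.
  by apply: (measurableT_comp mf); exact: measurable_cons_rV.
rewrite (_ : lebesgue_rV n.+1 = lebesgueS_rV (lebesgue_rV n) :> (set _ -> \bar R))//.
by rewrite /lebesgueS_rV ge0_integral_pushforward.
Qed.

Lemma integral_rV0 (f : 'rV[R]_0 -> \bar R) :
  measurable_fun setT f -> \int[lebesgue_rV 0]_x f x = f 0%R.
Proof. by move=> mf; rewrite /= integral_dirac// diracT mul1e. Qed.

Lemma lebesgue_measure_shift (c : R) (A : set R) : measurable A ->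
  pushforward (@lebesgue_measure R)
    (fun x : measurableTypeR R => (x + c)%R : measurableTypeR R) A =
  lebesgue_measure A.
Proof.
move=> mA.
have mc : measurable_fun setT (fun x : measurableTypeR R => (x + c)%R : measurableTypeR R).
  exact: measurable_funD.
pose mm := isMeasurableFun.Build _ _ _ _ _ mc.
pose h : {mfun measurableTypeR R >-> measurableTypeR R} :=
  HB.pack (fun x : measurableTypeR R => (x + c)%R) mm.
apply/esym/(@lebesgue_measure_unique R (pushforward lebesgue_measure h)) => //= _ [[a b]] _ <-.
rewrite /pushforward /=.
rewrite (_ : _ @^-1` _ = `](a - c)%R, (b - c)%R]%classic); last first.
  by apply/seteqP; split => x /=; rewrite !in_itv/= ltrBlDr lerBrDr.
rewrite !lebesgue_measure_itv/= !lte_fin ltrD2r.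
by case: ifPn => // _; rewrite -!EFinB; congr EFin; ring.
Qed.

Lemma ge0_integral_shift (f : R -> \bar R) (c : R) :
  measurable_fun setT f -> (forall x, 0 <= f x) ->
  \int[lebesgue_measure]_x f (x + c)%R = \int[lebesgue_measure]_x f x.
Proof.
move=> mf f0.
have mc : measurable_fun setT (fun x : measurableTypeR R => (x + c)%R : measurableTypeR R).
  exact: measurable_funD.
transitivity (\int[pushforward lebesgue_measure
    (fun x : measurableTypeR R => (x + c)%R : measurableTypeR R)]_x f x).
  by rewrite ge0_integral_pushforward.
by apply: eq_measure_integral => A mA _; exact: lebesgue_measure_shift.
Qed.

Lemma measurable_shift_rV n (z : 'rV[R]_n) :
  measurable_fun setT (fun x : 'rV[R]_n => (x + z)%R).
Proof.
apply/measurable_fun_rVP => i.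
under eq_fun do rewrite mxE.
by apply: measurable_funD => //; exact: measurable_coord_rV.
Qed.

Lemma cons_rVD n a b (x y : 'rV[R]_n) :
  (cons_rV (a, x) + cons_rV (b, y) = cons_rV (a + b, x + y))%R.
Proof. by rewrite /cons_rV [LHS](@add_row_mx _ 1 1 n) /= raddfD. Qed.

Lemma ge0_integral_shift_rV n (f : 'rV[R]_n -> \bar R) (z : 'rV[R]_n) :
  measurable_fun setT f -> (forall x, 0 <= f x) ->
  \int[lebesgue_rV n]_x f (x + z)%R = \int[lebesgue_rV n]_x f x.
Proof.
elim: n f z => [|n ih] f z mf f0.
  rewrite !integral_rV0//; first by congr f; apply/rowP => -[].
  by apply: (measurableT_comp mf); exact: measurable_shift_rV.
have mfz : measurable_fun setT (fun x : 'rV[R]_n.+1 => f (x + z)%R).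
  by apply: (measurableT_comp mf); exact: measurable_shift_rV.
apply: (etrans (ge0_integral_cons_rV mfz (fun x => f0 (x + z)%R))).
apply: (etrans _ (esym (ge0_integral_cons_rV mf f0))).
rewrite -(ge0_integral_shift (z ord0 ord0)
  (f := fun a => \int[lebesgue_rV n]_x f (cons_rV (a, x)))); last 2 first.
- apply: (measurable_fun_fubini_tonelli_F (fun ax => f (cons_rV ax))) => //.
  by apply: (measurableT_comp mf); exact: measurable_cons_rV.
- by move=> a; exact: integral_ge0.
apply: eq_integral => a _.
rewrite -(ih (fun x => f (cons_rV (a + z ord0 ord0, x)%R)) (@rsubmx _ 1 1 n z))//.
- apply: eq_integral => x _; congr f.
  by rewrite -[in LHS](uncons_rVK z) cons_rVD.
- apply: (measurableT_comp mf); apply: (measurableT_comp (@measurable_cons_rV R n)).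
  exact: measurable_pair1.
Qed.

(** * Cubes *)

Definition cube n (a : 'rV[R]_n) (r : R) : set 'rV[R]_n :=
  [set x | forall i, (`|x ord0 i - a ord0 i| < r)%R].

Lemma measurable_cube n (a : 'rV[R]_n) r : measurable (cube a r).
Proof.
rewrite (_ : cube a r =
    \bigcap_(i in [set: 'I_n])
      ((fun x : 'rV[R]_n => x ord0 i) @^-1`
        `](a ord0 i - r)%R, (a ord0 i + r)%R[%classic)); last first.
  apply/seteqP; split=> x /= h i.
    by move=> _; rewrite /= in_itv/= -ltr_distl h.
  by have := h i I; rewrite /= in_itv/= -ltr_distl.
apply: fin_bigcap_measurable; first exact: finite_finset.
move=> i _; rewrite -[X in measurable X]setTI.
exact: (@measurable_coord_rV R n i measurableT).
Qed.

Lemma lebesgue_cube n (a : 'rV[R]_n) r : (0 <= r)%R ->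
  lebesgue_rV n (cube a r) = ((2 * r) ^+ n)%:E.
Proof.
move=> r0.
transitivity (\prod_(i < n) (2 * r)%:E); last first.
  by rewrite prodEFin prodr_const card_ord.
rewrite (_ : cube a r = [set x : 'rV[R]_n | forall i,
    [set` `](a ord0 i - r)%R, (a ord0 i + r)%R[] (x ord0 i)]); last first.
  apply/seteqP; split=> x /= h i; have := h i; rewrite /= in_itv/=.
    by rewrite -ltr_distl.
  by rewrite -ltr_distl.
rewrite (lebesgue_rV_box (A := fun i => [set` `](a ord0 i - r)%R, (a ord0 i + r)%R[]))//.
apply: eq_bigr => i _; rewrite lebesgue_measure_itv/= lte_fin -EFinB.
case: ifPn => h; first by congr EFin; ring.
congr EFin; lra.
Qed.

Lemma le_integral_cube n (f : 'rV[R]_n -> \bar R) a r c : measurable_fun setT f ->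
  (forall x, 0 <= f x) -> (0 <= r)%R ->
  (forall x, cube a r x -> c%:E <= f x) ->
  (c * (2 * r) ^+ n)%:E <= \int[lebesgue_rV n]_(x in cube a r) f x.
Proof.
move=> mf f0 r0 cf.
rewrite EFinM -(lebesgue_cube a)//.
have [c0|c0] := leP 0%R c; last first.
  apply: (@le_trans _ _ 0); last exact: integral_ge0.
  by apply: mule_le0_ge0 => //; rewrite lee_fin ltW.
rewrite -integral_cst//; last exact: measurable_cube.
apply: ge0_le_integral => //; [exact: measurable_cube|exact: measurable_funTS].
Qed.

(** The step [v] moves coordinate [i] by at least the width of a cube, which makes the
    cubes disjoint. *)
Lemma le_integral_cubes n (f : 'rV[R]_n -> \bar R) (a v : 'rV[R]_n) r c (N : nat) i :
  measurable_fun setT f -> (forall x, 0 <= f x) ->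
  (0 <= r)%R -> (2 * r <= `|v ord0 i|)%R ->
  (forall k x, (k < N)%N -> cube (a + k%:R *: v)%R r x -> c%:E <= f x) ->
  (N%:R * (c * (2 * r) ^+ n))%:E <= \int[lebesgue_rV n]_x f x.
Proof.
move=> mf f0 r0 rv cf.
pose F k := cube (a + k%:R *: v)%R r.
have mF k : measurable (F k) by exact: measurable_cube.
apply: (@le_trans _ _
  (\int[lebesgue_rV n]_(x in \big[setU/set0]_(k <- iota 0 N) F k) f x)); last first.
  by apply: ge0_subset_integral => //; exact: bigsetU_measurable.
rewrite ge0_integral_bigsetU//; [|exact: iota_uniq| |exact: measurable_funTS]; last first.
- move=> j k _ _ [x [/(_ i) + /(_ i)]].
  rewrite !mxE => xj xk; apply/eqP.
  have : (`|(j%:R - k%:R) * v ord0 i| < 2 * r)%R.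
    move: xj xk; rewrite !ltr_norml => /andP[? ?] /andP[? ?].
    by rewrite mulrBl; apply/andP; split; lra.
  rewrite normrM => h; have : (`|j%:R - k%:R : R| < 1)%R.
    rewrite ltNge; apply/negP => h1.
    have := lt_le_trans h rv; rewrite ltNge => /negP; apply.
    by rewrite ler_peMl.
  have [jk|kj] := ltnP j k.
    rewrite distrC -natrB ?ger0_norm//; last exact: ltnW.
    by rewrite ltrn1 ltnS leqn0 subn_eq0 leqNgt jk.
  by rewrite -natrB// ger0_norm// ltrn1 ltnS leqn0 subn_eq0 => jk; rewrite eqn_leq jk kj.
apply: (@le_trans _ _ (\sum_(k <- iota 0 N) (c * (2 * r) ^+ n)%:E)).
  by rewrite sumEFin big_const_seq count_predT size_iota iter_addr_0 mulr_natl.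
rewrite big_seq [leRHS]big_seq; apply: lee_sum => k; rewrite mem_iota add0n => /andP[_ kN].
by apply: le_integral_cube => // x Fx; exact: cf Fx.
Qed.

Lemma ereal_eq_pinfty (x : \bar R) (c : R) : (0 < c)%R ->
  (forall N, (N%:R * c)%:E <= x) -> x = +oo.
Proof.
move=> c0; case: x => [x| |] // h; last by have := h 0%N.
have [N] : exists N : nat, (x / c < N%:R)%R.
  by exists (Num.truncn (x / c)).+1; rewrite truncnS_gt.
by rewrite ltr_pdivrMr// ltNge -lee_fin h.
Qed.

End lebesgue_rV_theory.

Section row_vectors.
Context {R : realType}.

Lemma le_integralT_cube n (f : 'rV[R]_n -> \bar R) a r c : measurable_fun setT f ->
  (forall x, (0 <= f x)%E) -> 0 <= r ->
  (forall x, cube a r x -> (c%:E <= f x)%E) ->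
  ((c * (2 * r) ^+ n)%:E <= \int[lebesgue_rV n]_x f x)%E.
Proof.
move=> mf f0 r0 cf; apply: (le_trans (le_integral_cube mf f0 r0 cf)).
by apply: ge0_subset_integral => //; exact: measurable_cube.
Qed.

Lemma cons_rV0 n a (x : 'rV[R]_n) : cons_rV (a, x) ord0 ord0 = a.
Proof. exact: (congr1 fst (cons_rVK (a, x))). Qed.

Lemma cons_rVS n a (x : 'rV[R]_n) i : cons_rV (a, x) ord0 (lift ord0 i) = x ord0 i.
Proof.
rewrite (_ : lift ord0 i = rshift 1 i); last exact/val_inj.
exact: row_mxEr.
Qed.

Lemma cons_rVZ n (k a : R) (x : 'rV[R]_n) :
  k *: cons_rV (a, x) = cons_rV (k * a, k *: x).
Proof. by rewrite /cons_rV [LHS](@scale_row_mx _ 1 1 n) /= scale_scalar_mx. Qed.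

Lemma ler_coord_norm n (x : 'rV[R]_n) i : `|x ord0 i| <= `|x|.
Proof.
rewrite [leRHS]/Num.norm /= mx_normrE.
by apply/bigmax_geP; right => /=; exists (ord0, i).
Qed.

Lemma dotp_cons n a b (x y : 'rV[R]_n) :
  dotp (cons_rV (a, x)) (cons_rV (b, y)) = a * b + dotp x y.
Proof.
rewrite /dotp big_ord_recl !cons_rV0; congr (_ + _).
by apply: eq_bigr => i _; rewrite !cons_rVS.
Qed.

Lemma dotpDl n (x y z : 'rV[R]_n) : dotp (x + y) z = dotp x z + dotp y z.
Proof. by rewrite /dotp -big_split; apply: eq_bigr => i _; rewrite mxE mulrDl. Qed.

Lemma dotpZl n k (x z : 'rV[R]_n) : dotp (k *: x) z = k * dotp x z.
Proof. by rewrite /dotp mulr_sumr; apply: eq_bigr => i _; rewrite mxE mulrA. Qed.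

Lemma dotpC n (x y : 'rV[R]_n) : dotp x y = dotp y x.
Proof. by apply: eq_bigr => i _; rewrite mulrC. Qed.

Lemma dotpDr n (x y z : 'rV[R]_n) : dotp z (x + y) = dotp z x + dotp z y.
Proof. by rewrite dotpC dotpDl !(dotpC _ z). Qed.

Lemma dotpZr n k (x z : 'rV[R]_n) : dotp z (k *: x) = k * dotp z x.
Proof. by rewrite dotpC dotpZl (dotpC x). Qed.

Lemma dotp0r n (x : 'rV[R]_n) : dotp x 0 = 0.
Proof. by rewrite /dotp big1// => i _; rewrite mxE mulr0. Qed.

Lemma dotpBl n (x y z : 'rV[R]_n) : dotp (x - y) z = dotp x z - dotp y z.
Proof. by rewrite dotpDl -scaleN1r dotpZl mulN1r. Qed.

Lemma measurable_dotp n (z : 'rV[R]_n) : measurable_fun setT (dotp z).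
Proof.
apply: measurable_sum => i; apply: measurable_funM => //.
exact: measurable_coord_rV.
Qed.

(** The sum norm is dual to the sup norm, whose balls are the cubes, for the pairing
    [dotp]: see [ler_dotp_norm1] and its partial converse [corner_cube]. *)
Definition norm1 n (x : 'rV[R]_n) : R := \sum_(i < n) `|x ord0 i|.

Lemma norm1_ge0 n (x : 'rV[R]_n) : 0 <= norm1 x.
Proof. exact: sumr_ge0. Qed.

Lemma norm1_gt0 n (v : 'rV[R]_n) : v != 0 -> 0 < norm1 v.
Proof.
move=> v0; rewrite lt_neqAle norm1_ge0 andbT eq_sym psumr_eq0//.
apply: contra v0 => /allP h; apply/eqP/rowP => i; rewrite mxE.
by have := h i; rewrite mem_index_enum normr_eq0 => /(_ isT)/eqP.
Qed.

Lemma measurable_norm1 n : measurable_fun setT (fun x : 'rV[R]_n => norm1 x).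
Proof.
apply: measurable_sum => i; apply: measurableT_comp => //.
exact: measurable_coord_rV.
Qed.

Lemma ler_dotp_norm1 n (x y : 'rV[R]_n) e : cube 0 e y ->
  `|dotp x y| <= e * norm1 x.
Proof.
move=> ye; rewrite /dotp /norm1 mulr_sumr (le_trans (ler_norm_sum _ _ _))//.
apply: ler_sum => i _; rewrite normrM mulrC ler_wpM2r//.
by have := ye i; rewrite mxE subr0; exact: ltW.
Qed.

(** The smaller cube sits in the corner of [cube 0 r] whose signs are those of [v]:
    there each product [v ord0 i * y ord0 i] is at least [r / 4 * `|v ord0 i|]. *)
Lemma corner_cube n (v : 'rV[R]_n) r : 0 < r -> exists2 b : 'rV[R]_n,
  cube b (r / 4) `<=` cube 0 r &
  forall y, cube b (r / 4) y -> r / 4 * norm1 v <= dotp v y.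
Proof.
move=> r0; exists (\row_i (r / 2 * Num.sg (v ord0 i))) => y yb; last first.
  rewrite /norm1 mulr_sumr; apply: ler_sum => i _.
  have := yb i; rewrite mxE; set s := v ord0 i; set t := y ord0 i.
  have -> : s * t = r / 2 * `|s| + s * (t - r / 2 * Num.sg s).
    by rewrite [in X in X + _]normrEsg; ring.
  set u := t - _ => /ltW ur.
  have : `|s * u| <= `|s| * (r / 4) by rewrite normrM ler_wpM2l.
  by rewrite ler_norml => /andP[? _]; lra.
move=> i; have := yb i; rewrite !mxE subr0; set t := y ord0 i => h.
have : `|r / 2 * Num.sg (v ord0 i)| <= r / 2.
  rewrite normrM gtr0_norm ?divr_gt0// normr_sg ler_piMr//; first by rewrite divr_ge0// ltW.
  by rewrite lern1 leq_b1.
by move: h; rewrite ler_norml !ltr_norml => /andP[? ?] /andP[? ?]; apply/andP; split; lra.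
Qed.

End row_vectors.

(** * Measurability and integrability *)

Section borel_rV.
Context {R : realType}.

Lemma nbhs_cubeP n (a : 'rV[R]_n) (A : set 'rV[R]_n) :
  nbhs a A <-> exists2 r, 0 < r & cube a r `<=` A.
Proof.
split=> [/nbhs_ballP[r /= r0 rA]|[r r0 rA]].
  exists r => // x ax; apply: rA; split => // i j.
  by rewrite (ord1 i) /ball/= distrC; exact: ax.
apply/nbhs_ballP; exists r => //= x [_ ax]; apply: rA => i.
by have := ax ord0 i; rewrite /ball/= distrC.
Qed.

(** An open set is the union of the cubes with rational centre and radius [1 / k.+1] in it. *)
Lemma open_measurable_rV n (U : set 'rV[R]_n) : open U -> measurable U.
Proof.
move=> oU.
pose C (qk : 'rV[rat]_n * nat) : set 'rV[R]_n :=
  cube (map_mx ratr qk.1) qk.2.+1%:R^-1.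
have -> : U = \bigcup_(qk in [set qk | C qk `<=` U]) C qk.
  apply/seteqP; split => [x Ux|x [qk /= qkU]]; last exact: qkU.
  have [r r0 xrU] := (nbhs_cubeP x U).1 (oU x Ux).
  have [k kr] : exists k : nat, k.+1%:R^-1 < r / 2.
    exists (Num.truncn (r / 2)^-1).
    by rewrite invf_plt ?posrE ?divr_gt0//; exact: truncnS_gt.
  have /choice[q qx] : forall i : 'I_n, exists q : rat,
      ratr q \in `](x ord0 i - k.+1%:R^-1), (x ord0 i + k.+1%:R^-1)[.
    by move=> i; apply: rat_in_itvoo; rewrite ltrD2l gtrN.
  exists (\row_i q i, k) => [y|i] /=; last first.
    by have := qx i; rewrite !mxE in_itv/= -ltr_distl distrC.
  move=> yq; apply: xrU => i; have := yq i; rewrite /= !mxE.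
  have := qx i; rewrite in_itv/= -ltr_distl.
  move: kr; move: (k.+1%:R^-1) => e er; rewrite !ltr_norml => /andP[? ?] /andP[? ?].
  by apply/andP; split; lra.
rewrite bigcup_mkcond; apply: countable_bigcupT_measurable.
  exact: countableP.
by move=> qk; case: ifP => // _; exact: measurable_cube.
Qed.

Lemma bounded_seq_cluster n (z : nat -> 'rV[R]_n) B :
  (forall k i, `|z k ord0 i| <= B) ->
  exists l, forall j, exists2 k, (j <= k)%N & cube l j.+1%:R^-1 (z k).
Proof.
move=> zB.
have := @rV_compact R n (fun=> `[- B, B]%classic) (fun=> @segment_compact _ _ _).
move=> /(_ (z @ \oo) _)[].
  by exists 0%N => // k _ i /=; rewrite in_itv/= -ler_norml.
move=> l [_ cl]; exists l => j.
have [] := cl [set z k | k in [set k | (j <= k)%N]] (cube l j.+1%:R^-1).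
- by exists j => // k /= jk; exists k.
- by apply/nbhs_cubeP; exists j.+1%:R^-1.
by move=> _ [[k /= jk <-] lk]; exists k.
Qed.

Lemma lower_semicontinuous_measurable_rV n (f : 'rV[R]_n -> \bar R) :
  lower_semicontinuous f -> measurable_fun setT f.
Proof.
move=> scif; apply: (measurability _ (ErealGenOInfty.measurableE R)).
move=> /= _ [_ [a ->]] <-; apply: measurableI => //; apply: open_measurable_rV.
by rewrite preimage_itvoy; move/lower_semicontinuousP : scif; exact.
Qed.

Lemma measurable_expeR : measurable_fun [set: \bar R] (@expeR R).
Proof.
apply: (measurability _ (ErealGenOInfty.measurableE R)).
move=> /= _ [_ [a ->]] <-; rewrite setTI preimage_itvoy.
have [a0|a0] := ltP a 0.
  rewrite [X in measurable X](_ : _ = setT)//; apply/seteqP; split => // x _ /=.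
  by rewrite (lt_le_trans _ (expeR_ge0 x))// lte_fin.
rewrite [X in measurable X](_ : _ = [set x | lne a%:E < x]%E).
  by rewrite -[X in measurable X]setTI; exact: emeasurable_fun_o_infty.
have aE : expeR (lne a%:E) = a%:E by rewrite lneK// in_itv/= lee_fin a0 leey.
by apply/seteqP; split => x /=; rewrite -[X in (X < expeR _)%E]aE lte_expeR.
Qed.

Lemma measurable_lne : measurable_fun [set: \bar R] (@lne R).
Proof.
apply: (measurability _ (ErealGenOInfty.measurableE R)).
move=> /= _ [_ [a ->]] <-; rewrite setTI preimage_itvoy.
rewrite [X in measurable X](_ : _ = [set x | expeR a%:E < x]%E).
  by rewrite -[X in measurable X]setTI; exact: emeasurable_fun_o_infty.
have xE (x : \bar R) : (0 <= x)%E -> expeR (lne x) = x.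
  by move=> x0; rewrite lneK// in_itv/= x0 leey.
apply/seteqP; split => x /=; have [x0|x0] := ltP x 0%E.
- by rewrite le0_lneNy// ltW.
- by move=> ax; rewrite -lte_expeR xE in ax.
- by move=> ax; have := lt_trans (le_lt_trans (expeR_ge0 a%:E) ax) x0; rewrite ltxx.
- by move=> ax; rewrite -lte_expeR xE.
Qed.

Lemma ge0_integral_prod_lty n (f : R -> R) : measurable_fun setT f ->
  (forall x, 0 <= f x) -> (\int[lebesgue_measure]_x (f x)%:E < +oo)%E ->
  (\int[lebesgue_rV n]_x (\prod_(i < n) f (x ord0 i))%:E < +oo)%E.
Proof.
move=> mf f0 foo.
have mp m : measurable_fun setT (fun x : 'rV[R]_m => (\prod_(i < m) f (x ord0 i))%:E).
  apply/measurable_EFinP; apply: measurable_prod => i _.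
  by apply: (measurableT_comp mf); exact: measurable_coord_rV.
have p0 m (x : 'rV[R]_m) : (0 <= (\prod_(i < m) f (x ord0 i))%:E)%E.
  by rewrite lee_fin; exact: prodr_ge0.
elim: n => [|n ih].
  rewrite integral_rV0//; exact: ltry.
rewrite (ge0_integral_cons_rV (mp _) (p0 _)).
under eq_integral => a _.
  under eq_integral => x _.
    rewrite big_ord_recl.
    rewrite (_ : cons_rV (a, x) ord0 ord0 = a); last first.
      exact: (congr1 fst (cons_rVK (a, x))).
    under eq_bigr => i _.
      rewrite (_ : cons_rV (a, x) ord0 (lift ord0 i) = x ord0 i); last first.
        rewrite (_ : lift ord0 i = rshift 1 i); last exact/val_inj.
        exact: row_mxEr.
      over.
    rewrite EFinM.
    over.
  rewrite ge0_integralZl_EFin//; last exact: mp.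
  over.
rewrite ge0_integralZr//.
- rewrite lte_mul_pinfty ?integral_ge0 ?ge0_fin_numE// => *;
    by rewrite ?integral_ge0// => *; rewrite lee_fin.
- exact/measurable_EFinP.
- by move=> x _; rewrite lee_fin.
- by apply: integral_ge0 => x _; exact: p0.
Qed.

Lemma integral_exp_abs_lty (rho : R) : 0 < rho ->
  (\int[lebesgue_measure]_x (expR (- rho * `|x|))%:E < +oo)%E.
Proof.
move=> rho0.
have cf : continuous (fun x : R => expR (- rho * `|x|)).
  move=> x; apply: continuous_comp; last exact: continuous_expR.
  by apply: continuousM; [exact: cst_continuous|exact: norm_continuous].
rewrite ge0_symfun_integralT//; last by move=> x /=; rewrite normrN.
have mD : measurable [set x : R | 0 <= x] by rewrite -set_itvcy.
apply: lte_mul_pinfty => //.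
apply: (@le_lt_trans _ _
  (\int[lebesgue_measure]_x (rho^-1 * exponential_pdf rho x)%:E)%E); last first.
  under eq_integral do rewrite EFinM.
  rewrite ge0_integralZl_EFin//=; last 3 first.
  - by move=> x _; rewrite lee_fin exponential_pdf_ge0// ltW.
  - by apply/measurable_EFinP; exact: measurable_exponential_pdf.
  - by rewrite invr_ge0 ltW.
  by rewrite integral_exponential_pdf// mule1 ltry.
apply: (@le_trans _ _ (\int[lebesgue_measure]_(x in [set x : R | (0 <= x)%R])
  (rho^-1 * exponential_pdf rho x)%:E)%E).
  rewrite le_eqVlt; apply/orP; left; apply/eqP.
  apply: eq_integral => x; rewrite inE/= => x0.
  by rewrite exponential_pdfE// mulKf ?gt_eqF// ger0_norm.
apply: ge0_subset_integral => //.
- apply/measurable_EFinP; apply: measurable_funM => //.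
  exact: measurable_exponential_pdf.
- by move=> x _; rewrite lee_fin mulr_ge0 ?invr_ge0 ?exponential_pdf_ge0 ?ltW.
Qed.

Lemma integral_exp_norm1_lty n (rho : R) : 0 < rho ->
  (\int[lebesgue_rV n]_x (expR (- rho * norm1 x))%:E < +oo)%E.
Proof.
move=> rho0; under eq_integral do rewrite /norm1 mulr_sumr expR_sum.
apply: (@ge0_integral_prod_lty n (fun t => expR (- rho * `|t|))).
- by apply: measurableT_comp => //; apply: measurable_funM => //; exact: measurable_normr.
- by move=> x; exact: expR_ge0.
- exact: integral_exp_abs_lty.
Qed.

End borel_rV.

(** * Convex sets *)

Section convex_sets.
Context {R : realType}.

Definition convex_rV n (C : set 'rV[R]_n) := forall x y t, C x -> C y ->
  0 <= t <= 1 -> C (t *: x + (1 - t) *: y).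

Lemma convex_cube_star n (C : set 'rV[R]_n) a r x t : convex_rV C ->
  cube a r `<=` C -> C x -> 0 <= t < 1 ->
  cube (t *: x + (1 - t) *: a) ((1 - t) * r) `<=` C.
Proof.
move=> cC aC Cx /andP[t0 t1] u xu.
have t1' : 0 < 1 - t by rewrite subr_gt0.
rewrite (_ : u = t *: x + (1 - t) *: ((1 - t)^-1 *: (u - t *: x))); last first.
  by rewrite scalerA mulfV ?gt_eqF// scale1r addrC subrK.
apply: cC => //; last by rewrite t0 ltW.
apply: aC => i; have := xu i; rewrite !mxE => h.
rewrite (_ : _ - _ = (1 - t)^-1 * (u ord0 i - (t * x ord0 i + (1 - t) * a ord0 i))).
  by rewrite normrM gtr0_norm ?invr_gt0// mulrC ltr_pdivrMr// (mulrC r).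
by field; rewrite gt_eqF.
Qed.

(** Induction on the dimension avoids affine hulls.  By Fubini, two slices at
    different heights [a1] and [a2] have positive measure, so each contains a cube; the
    convex hull of these two cubes contains a cube around its midpoint. *)
Lemma convex_pos_measure_cube n (C : set 'rV[R]_n) : measurable C -> convex_rV C ->
  (0 < lebesgue_rV n C)%E -> exists a, exists2 r : R, 0 < r & cube a r `<=` C.
Proof.
elim: n C => [|n ih] C mC cC C0.
  have [x Cx] : C !=set0.
    by apply/set0P; apply: contraTneq C0 => ->; rewrite measure0 ltxx.
  exists x, 1 => // y _; suff -> : y = x by [].
  by apply/rowP => -[].
pose S a := (fun x => cons_rV (a, x)) @^-1` C.
have mS a : measurable (S a).
  have mc : measurable_fun setT (fun x : 'rV[R]_n => cons_rV (a, x)).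
    by apply: (measurableT_comp (@measurable_cons_rV R n)); exact: measurable_pair1.
  by rewrite -[S a]setTI; exact: mc.
pose P := [set a : R | (0 < lebesgue_rV n (S a))%E].
have CE : lebesgue_rV n.+1 C = (\int[lebesgue_measure]_a lebesgue_rV n (S a))%E.
  rewrite -[LHS]mul1e -[LHS]integral_cst//.
  rewrite integral_mkcond ge0_integral_cons_rV; last 2 first.
  - apply/measurable_restrict => //.
  - by move=> x; exact: erestrict_ge0.
  apply: eq_integral => a _; rewrite -[RHS]mul1e -[RHS]integral_cst//.
  by rewrite [RHS]integral_mkcond.
have NP a0 : ~ (P `<=` [set a0]).
  move=> Pa0; move: C0; rewrite CE.
  rewrite [X in (0 < X)%E](_ : _ = \int[lebesgue_measure]_(a in P) lebesgue_rV n (S a))%E.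
    by rewrite (integral_Sset1 _ Pa0) ltxx.
  rewrite [RHS]integral_mkcond; apply: eq_integral => a _; rewrite patchE.
  case: ifPn => //; rewrite notin_setE/= => /negP.
  by rewrite -leNgt measure_le0 => /eqP.
have [a1 Pa1] : P !=set0.
  by apply/set0P/negP => /eqP P0; apply: (NP 0); rewrite P0.
have [a2 Pa2 a12] : exists2 a2, P a2 & a2 != a1.
  apply: contrapT => h; apply: (NP a1) => a Pa /=; apply: contrapT => /eqP aa1.
  by apply: h; exists a.
have cS a : convex_rV (S a).
  move=> x y t Sx Sy t01; have := cC _ _ _ Sx Sy t01.
  rewrite !cons_rVZ cons_rVD /S/= -mulrDl.
  by rewrite (addrC t) subrK mul1r.
have [c1 [r1 r10 h1]] := ih _ (mS _) (cS _) Pa1.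
have [c2 [r2 r20 h2]] := ih _ (mS _) (cS _) Pa2.
pose r := Num.min r1 r2; pose d := `|a2 - a1|; pose K := `|c1 - c2|.
have r0 : 0 < r by rewrite lt_min r10.
have d0 : 0 < d by rewrite normr_gt0 subr_eq0.
have K0 : 0 <= K by exact: normr_ge0.
exists (cons_rV ((a1 + a2) / 2, 2^-1 *: (c1 + c2))).
(* A point [(b, x)] of the new cube is on the segment from [(a1, c1 + e)] to
   [(a2, c2 + e)].  The first bound puts its weight [t] between 0 and 1; the second one
   makes [e] smaller than [r]. *)
exists (Num.min (d / 2) (r * d / (d + K))).
  by rewrite lt_min !divr_gt0// ?mulr_gt0// ltr_wpDr.
move=> w hw; rewrite -(uncons_rVK w); case E : (uncons_rV w) => [b x].
rewrite -(uncons_rVK w) E in hw.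
have := hw ord0; rewrite !cons_rV0 lt_min => /andP[hb1 hb2].
have {}hw i := hw (lift ord0 i).
pose t := (b - a2) / (a1 - a2).
have a120 : a1 - a2 != 0 by rewrite subr_eq0 eq_sym.
have tE : t - 2^-1 = (b - (a1 + a2) / 2) / (a1 - a2) by rewrite /t; field.
have t12 : `|t - 2^-1| < 2^-1.
  by rewrite tE normrM normfV (distrC a1) ltr_pdivrMr -/d// [ltRHS]mulrC.
have tr : `|t - 2^-1| < r / (d + K).
  rewrite tE normrM normfV (distrC a1) ltr_pdivrMr -/d//.
  by rewrite mulrAC.
pose e := x - (t *: c1 + (1 - t) *: c2).
have ee i : `|e ord0 i| < r.
  have := hw i; rewrite !cons_rVS !mxE lt_min => /andP[_ hx].
  rewrite (_ : _ - _ = (x ord0 i - 2^-1 * (c1 ord0 i + c2 ord0 i)) -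
    (t - 2^-1) * (c1 ord0 i - c2 ord0 i)); last by field.
  apply: (le_lt_trans (ler_normB _ _)).
  apply: (@lt_le_trans _ _ (r * d / (d + K) + r / (d + K) * K)); last first.
    by rewrite le_eqVlt; apply/orP; left; apply/eqP; field; rewrite gt_eqF// ltr_wpDr.
  apply: ltr_leD => //; rewrite normrM; apply: ler_pM => //; first exact: ltW.
  by have := ler_coord_norm (c1 - c2) i; rewrite !mxE.
rewrite (_ : cons_rV _ = t *: cons_rV (a1, c1 + e) + (1 - t) *: cons_rV (a2, c2 + e)).
  apply: cC.
  - apply: h1 => i; rewrite [(c1 + e) _ _]mxE addrAC subrr add0r.
    by rewrite (lt_le_trans (ee i))// ge_min lexx.
  - apply: h2 => i; rewrite [(c2 + e) _ _]mxE addrAC subrr add0r.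
    by rewrite (lt_le_trans (ee i))// ge_min lexx orbT.
  - by move: t12; rewrite ltr_norml => /andP[? ?]; apply/andP; split; lra.
rewrite !cons_rVZ cons_rVD; congr (cons_rV (_, _)); first by rewrite /t; field.
by apply/rowP => i; rewrite !mxE; ring.
Qed.

(** Induction on the dimension.  If the first coordinate keeps a constant sign on
    [C], that coordinate gives the vector.  Otherwise the slice at height 0 is nonempty
    and has a separating vector [th].  Projecting each [cons_rV (a, y)] in [C] to the
    pair [(a, dotp y th)] gives a planar convex set that misses the open upper half of
    the vertical axis; the supremum of the slopes [dotp y th / a] over its right half is
    the slope of a line through the origin that lies above this set. *)
Lemma convex_separation n (C : set 'rV[R]_n) : convex_rV C -> C !=set0 -> ~ C 0 ->
  exists2 th : 'rV[R]_n, th != 0 & forall x, C x -> dotp x th <= 0.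
Proof.
elim: n C => [|n ih] C cC [x0 Cx0] C0.
  by exfalso; apply: C0; rewrite (_ : 0 = x0)//; apply/rowP => -[].
have cons_neq0 (b : R) (y : 'rV[R]_n) : (b != 0) || (y != 0) -> cons_rV (b, y) != 0.
  apply: contraTneq => h; rewrite negb_or !negbK.
  have /= := congr1 (fun v : 'rV_n.+1 => v ord0 ord0) h; rewrite cons_rV0 mxE => ->.
  rewrite eqxx/=; apply/eqP/rowP => i.
  by have := congr1 (fun v : 'rV_n.+1 => v ord0 (lift ord0 i)) h; rewrite cons_rVS !mxE.
have [Cle|] := pselect (forall a x, C (cons_rV (a, x)) -> a <= 0).
  exists (cons_rV (1, 0)); first by rewrite cons_neq0 ?oner_eq0.
  move=> x; rewrite -(uncons_rVK x); case: (uncons_rV x) => a y /Cle.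
  by rewrite dotp_cons mulr1 dotp0r addr0.
move=> /existsNP[t1] /existsNP[x1] /not_implyP[C1 /negP]; rewrite -ltNge => t10.
have [Cge|] := pselect (forall a x, C (cons_rV (a, x)) -> 0 <= a).
  exists (cons_rV (- 1, 0)); first by rewrite cons_neq0 ?oppr_eq0 ?oner_eq0.
  move=> x; rewrite -(uncons_rVK x); case: (uncons_rV x) => a y /Cge.
  by rewrite dotp_cons mulrN1 dotp0r addr0 oppr_le0.
move=> /existsNP[t2] /existsNP[x2] /not_implyP[C2 /negP]; rewrite -ltNge => t20.
pose D := [set y | C (cons_rV (0, y))].
have comb a1 y1 a2 y2 : 0 < a1 -> a2 < 0 -> C (cons_rV (a1, y1)) ->
    C (cons_rV (a2, y2)) ->
    D ((- a2 / (a1 - a2)) *: y1 + (1 - (- a2 / (a1 - a2))) *: y2).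
  move=> a10 a20 h1 h2.
  have a12 : 0 < a1 - a2 by rewrite subr_gt0 (lt_trans a20).
  have := cC _ _ (- a2 / (a1 - a2)) h1 h2; rewrite !cons_rVZ cons_rVD.
  rewrite (_ : _ * a1 + _ = 0); last by field; rewrite gt_eqF.
  apply; apply/andP; split; first by rewrite divr_ge0// ?oppr_ge0 ltW.
  by rewrite ler_pdivrMr// mul1r lerDr ltW.
have [|||th th0 Dth] := ih D.
- move=> x y t Dx Dy t01; have := cC _ _ _ Dx Dy t01.
  by rewrite !cons_rVZ cons_rVD /D/= !mulr0 addr0.
- by exists ((- t2 / (t1 - t2)) *: x1 + (1 - (- t2 / (t1 - t2))) *: x2); exact: comb.
- rewrite /D/=; suff -> : cons_rV (0, 0) = 0 :> 'rV[R]_n.+1 by [].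
  by apply/rowP => i; case: (unliftP ord0 i) => [j ->|->]; rewrite ?cons_rVS ?cons_rV0 !mxE.
pose S := [set s | exists a y, [/\ 0 < a, C (cons_rV (a, y)) & s = dotp y th / a]].
have Sub a y : a < 0 -> C (cons_rV (a, y)) -> ubound S (dotp y th / a).
  move=> a0 h2 _ [b [y1 [b0 h1 ->]]].
  have := Dth _ (comb _ _ _ _ b0 a0 h1 h2); rewrite dotpDl !dotpZl.
  have ba : 0 < b - a by rewrite subr_gt0 (lt_trans a0).
  rewrite [X in X <= 0 -> _](_ : _ =
    (b * dotp y th - a * dotp y1 th) / (b - a)); last by field; rewrite gt_eqF.
  rewrite ler_pdivrMr// mul0r subr_le0 => h.
  rewrite ler_pdivrMr// mulrAC ler_ndivlMr//.
  by rewrite mulrC [leRHS]mulrC.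
have supS : has_sup S.
  split; first by exists (dotp x1 th / t1), t1, x1.
  by exists (dotp x2 th / t2); exact: Sub.
exists (cons_rV (- sup S, th)); first by rewrite cons_neq0// th0 orbT.
move=> x; rewrite -(uncons_rVK x); case: (uncons_rV x) => a y Cx.
rewrite dotp_cons mulrN addrC subr_le0.
have [a0|a0|a0] := ltgtP a 0.
- have : sup S <= dotp y th / a by apply: ge_sup => //; [case: supS|exact: Sub].
  by rewrite ler_ndivlMr// mulrC.
- have : dotp y th / a <= sup S by apply: ub_le_sup; [case: supS|exists a, y].
  by rewrite ler_pdivrMr// mulrC.
- by rewrite a0 mul0r; apply: Dth; rewrite /D/= -a0.
Qed.

(** Separation is applied to the interior of [C] only, since [z] may belong to [C];
    the inequality extends to [C] along the segments that join its points to [a]. *)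
Lemma convex_supporting n (C : set 'rV[R]_n) (a z : 'rV[R]_n) r : convex_rV C ->
  0 < r -> cube a r `<=` C -> ~ interior C z ->
  exists2 th : 'rV[R]_n, th != 0 & forall x, C x -> dotp (x - z) th <= 0.
Proof.
move=> cC r0 aC zC.
pose I := [set u | exists2 s, 0 < s & cube (u + z) s `<=` C].
have Istar x t : C x -> 0 <= t < 1 -> I (t *: x + (1 - t) *: a - z).
  move=> Cx t01; exists ((1 - t) * r); last by rewrite subrK; exact: convex_cube_star.
  by rewrite mulr_gt0// subr_gt0; case/andP: t01.
have [|||th th0 Ith] := @convex_separation n I.
- move=> x y t [s s0 xs] [u u0 yu] t01.
  exists (Num.min s u); first by rewrite lt_min s0.
  move=> w hw.
  pose e := w - (t *: x + (1 - t) *: y + z).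
  rewrite (_ : w = t *: (x + z + e) + (1 - t) *: (y + z + e)).
    apply: cC => //; [apply: xs|apply: yu] => i; have := hw i;
      rewrite lt_min => /andP[h1 h2];
      by rewrite [(_ + e) _ _]mxE addrAC subrr add0r /e mxE [X in _ + X]mxE.
  by apply/rowP => i; rewrite !mxE; ring.
- have Ca : C a by apply: aC => i; rewrite subrr normr0.
  exists (a - z); have := Istar a 0 Ca; rewrite scale0r add0r subr0 scale1r.
  by apply; rewrite lexx ltr01.
- by move=> [s s0]; rewrite add0r => zs; apply: zC; apply/nbhs_cubeP; exists s.
exists th => // x Cx; rewrite leNgt; apply/negP => B0.
pose A := dotp (a - z) th; pose B := dotp (x - z) th; rewrite -/B in B0.
have BA : 0 < B + `|A| by rewrite ltr_pwDl.
(* With this weight the combination of [B] and [A] is still at least [B / 2]. *)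
pose e := B / (2 * (B + `|A|)).
have e0 : 0 < e by rewrite divr_gt0// mulr_gt0.
have e1 : e <= 2^-1.
  by rewrite /e ler_pdivrMr ?mulr_gt0// mulKf// lerDl.
have := Ith _ (Istar x (1 - e) Cx _); rewrite subKr.
rewrite (_ : _ - z = (1 - e) *: (x - z) + e *: (a - z)); last first.
  by apply/rowP => i; rewrite !mxE; ring.
rewrite dotpDl !dotpZl -/A -/B => h.
have : (1 - e) * B + e * A <= 0 by apply: h; apply/andP; split; lra.
apply/negP; rewrite -ltNge.
have : e * (B + `|A|) = B / 2 by rewrite /e; field; rewrite gt_eqF.
have : e * - `|A| <= e * A by rewrite ler_pM2l// lerNl -normrN ler_norm.
by move=> ? ?; lra.
Qed.

End convex_sets.

(** * Growth of integrable convex functions *)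

Section convex_functions.
Context {R : realType} {n : nat} (phi : 'rV[R]_n -> \bar R).
Hypothesis phiNy : forall x, phi x != -oo%E.
Hypothesis cphi : convex_efun phi.

Definition sublevel (M : R) := [set x | (phi x <= M%:E)%E].

Lemma convex_efun_le x y t (a b : R) : (phi x <= a%:E)%E -> (phi y <= b%:E)%E ->
  0 <= t <= 1 -> (phi (t *: x + (1 - t) *: y) <= (t * a + (1 - t) * b)%:E)%E.
Proof.
move=> xa yb t01; apply: (le_trans (cphi _ _ t01)).
rewrite [leRHS]EFinD !EFinM; case/andP: t01 => t0 t1.
by apply: leeD; apply: lee_wpmul2l => //; rewrite lee_fin// subr_ge0.
Qed.

Lemma convex_sublevel M : convex_rV (sublevel M).
Proof.
move=> x y t xM yM t01; have := convex_efun_le xM yM t01.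
by rewrite -mulrDl (addrC t) subrK mul1r.
Qed.

Lemma sublevelS M M' : M <= M' -> sublevel M `<=` sublevel M'.
Proof. by move=> MM' x /le_trans; apply; rewrite lee_fin. Qed.

Lemma edom_sublevel x : (phi x < +oo)%E -> exists M, sublevel M x.
Proof.
case E : (phi x) => [r| |] // _; last by have := phiNy x; rewrite E.
by exists r; rewrite /sublevel/= E.
Qed.

Lemma sublevel_edom M x : sublevel M x -> (phi x < +oo)%E.
Proof. by move=> /le_lt_trans; apply; exact: ltry. Qed.

Lemma convex_edom : convex_rV [set x | (phi x < +oo)%E].
Proof.
move=> x y t /edom_sublevel[M xM] /edom_sublevel[M' yM'] t01.
by apply: le_lt_trans (convex_efun_le xM yM' t01) _; exact: ltry.
Qed.

Lemma measurable_sublevel M : measurable_fun setT phi -> measurable (sublevel M).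
Proof.
move=> mphi; rewrite -[sublevel M]setTI.
exact: emeasurable_fun_infty_c.
Qed.

(** Otherwise every sublevel set is null, hence so is the domain of [phi]. *)
Lemma vol_gt0_sublevel_cube : measurable_fun setT phi -> (0 < vol phi)%E ->
  exists M a, exists2 r : R, 0 < r & cube a r `<=` sublevel M.
Proof.
move=> mphi; apply: contraPP => h.
have S0 k : lebesgue_rV n (sublevel k%:R) = 0%E.
  apply/eqP; rewrite -measure_le0 leNgt; apply/negP => /convex_pos_measure_cube.
  move=> /(_ (measurable_sublevel _ mphi) (@convex_sublevel _)) [a [r r0 ar]].
  by apply: h; exists k%:R, a, r.
apply/negP; rewrite -leNgt /vol.
rewrite [leLHS](_ : _ = 0)%E//.
have mE : measurable_fun setT (fun x => expeR (- phi x)).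
  by apply: measurableT_comp; [exact: measurable_expeR|exact: measurableT_comp].
pose N := \bigcup_k sublevel k%:R.
have mN : measurable N by apply: bigcup_measurable => k _; exact: measurable_sublevel.
have N0 : lebesgue_rV n N = 0%E.
  apply/eqP; rewrite -measure_le0.
  have mS k := measurable_sublevel k%:R mphi.
  apply: (le_trans (measure_sigma_subadditive _ mS mN _)) => //.
  by rewrite eseries0// => k _ _; exact: S0.
rewrite (ge0_negligible_integral mN)//; last by move=> x _; exact: expeR_ge0.
rewrite integral0_eq// => x [_ /=]; case E : (phi x) => [s| |]; rewrite ?E//.
  move=> H; exfalso; apply: H; exists (Num.truncn `|s|).+1 => //=.
  rewrite /sublevel/= E lee_fin (le_trans (ler_norm s))//.
  by apply/ltW/truncnS_gt.
by have := phiNy x; rewrite E.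
Qed.

(** From a point [x] of [sublevel (M + 1)] the segment to [a] carries, on its half near
    [a], disjoint cubes of radius [r / 2] inside that sublevel set.  Their number grows
    with the distance from [x] to [a], and the finite volume of [phi] bounds it. *)
Lemma sublevel_bounded a r M : measurable_fun setT phi -> (vol phi < +oo)%E ->
  0 < r -> cube a r `<=` sublevel M ->
  exists2 rho : R, 0 < rho & forall (x : 'rV[R]_n) i,
    rho <= `|x ord0 i - a ord0 i| -> ((M + 1)%:E < phi x)%E.
Proof.
move=> mphi; case V : (vol phi) => [v| |] // _ r0 arM; last first.
  have : (0 <= vol phi)%E by apply: integral_ge0 => x _; exact: expeR_ge0.
  by rewrite V.
pose c := expR (- (M + 1)) * (2 * (r / 2)) ^+ n.
have c0 : 0 < c by rewrite mulr_gt0 ?expR_gt0// exprn_gt0// mulr_gt0// divr_gt0.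
pose N := (Num.truncn (v / c)).+1.
have Nv : v < N%:R * c by rewrite -ltr_pdivrMr// truncnS_gt.
have N1 : 0 < N%:R :> R by rewrite ltr0n.
(* The centres divide the segment into [K] parts; the first [N] of them are on the half
   near [a]. *)
pose K : R := 2 * N%:R + 1.
have K0 : 0 < K by rewrite /K; lra.
exists (K * r); first by rewrite mulr_gt0.
move=> x i xi; rewrite ltNge; apply/negP => xM.
have : ((N%:R * c)%:E <= vol phi)%E.
  apply: (@le_integral_cubes _ _ _ a (K^-1 *: (x - a)) (r / 2) _ _ i).
  - apply: measurableT_comp; first exact: measurable_expeR.
    exact: measurableT_comp.
  - by move=> ?; exact: expeR_ge0.
  - by rewrite divr_ge0// ltW.
  - rewrite !mxE normrM gtr0_norm ?invr_gt0// [leRHS]mulrC ler_pdivlMr//.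
    by rewrite (_ : _ * _ * _ = K * r)//; field.
  - move=> k u kN ku.
    have kN' : k%:R <= N%:R :> R by rewrite ler_nat ltnW.
    have k0 : 0 <= k%:R :> R by [].
    suff : sublevel (M + 1) u.
      rewrite /sublevel/= => uM.
      by rewrite -[(expR _)%:E]/(expeR (- (M + 1))%:E) lee_expeR EFinN leeN2.
    have t12 : k%:R / K <= 2^-1 by rewrite ler_pdivrMr// /K; lra.
    have t0 : 0 <= k%:R / K by rewrite divr_ge0// ltW.
    apply: (@convex_cube_star _ _ _ a r x (k%:R / K) (@convex_sublevel _) _ xM).
    + by apply: subset_trans arM _; apply: sublevelS; lra.
    + by rewrite t0/=; lra.
    + move=> j; have := ku j; rewrite !mxE => h.
      rewrite (_ : _ - _ = u ord0 j - (a ord0 j + k%:R * (K^-1 * (x ord0 j - a ord0 j)))).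
        apply: lt_le_trans h _; rewrite [leLHS]mulrC ler_wpM2r ?(ltW r0)//; lra.
      by field; rewrite gt_eqF.
by rewrite V lee_fin leNgt Nv.
Qed.

(** Far from [a], compare [phi x] with the value at distance [rho] on the segment from
    [a] to [x], where [phi] has already increased by 1.  Near [a], compare with the
    point opposite to [x] in the cube, where [phi] is at most [M]. *)
Lemma convex_linear_growth a r M : measurable_fun setT phi -> (vol phi < +oo)%E ->
  0 < r -> cube a r `<=` sublevel M ->
  exists c C : R, 0 < c /\ forall x, ((c * norm1 x - C)%:E <= phi x)%E.
Proof.
move=> mphi Voo r0 arM.
have [rho rho0 Hrho] := sublevel_bounded mphi Voo r0 arM.
have far (x : 'rV[R]_n) i : rho <= `|x ord0 i - a ord0 i| ->
    ((M + `|x ord0 i - a ord0 i| / rho)%:E <= phi x)%E.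
  set d := `|_| => rd.
  have d0 : 0 < d by rewrite (lt_le_trans rho0).
  case E : (phi x) => [f| |]; [|exact: leey|by have := phiNy x; rewrite E].
  have aM : sublevel M a by apply: arM => j; rewrite subrr normr0.
  have t01 : 0 <= rho / d <= 1.
    by apply/andP; split; [rewrite divr_ge0// ltW|rewrite ler_pdivrMr// mul1r].
  have xf : (phi x <= f%:E)%E by rewrite E.
  have := convex_efun_le xf aM t01.
  have /Hrho/lt_le_trans : rho <= `|(rho / d *: x + (1 - rho / d) *: a) ord0 i - a ord0 i|.
    rewrite !mxE (_ : _ - _ = rho / d * (x ord0 i - a ord0 i)); last by ring.
    by rewrite normrM -/d gtr0_norm ?divr_gt0// divfK// gt_eqF.
  move=> /[apply]; rewrite !lte_fin lee_fin => h.
  rewrite addrC -lerBrDr ler_pdivrMr//.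
  have : d < rho / d * (f - M) * d.
    by rewrite -[ltLHS]mul1r ltr_pM2r//; move: h; set t := rho / d; lra.
  by rewrite mulrAC divfK ?gt_eqF// mulrC => /ltW.
have [m Hm] : exists m, forall x, cube a rho x -> (m%:E <= phi x)%E.
  have aM : sublevel M a by apply: arM => j; rewrite subrr normr0.
  case Ea : (phi a) => [f0| |]; last 2 first.
    by have := sublevel_edom aM; rewrite Ea.
    by have := phiNy a; rewrite Ea.
  (* [a] is the combination with weight [l] of [x] and of the opposite point
     [a - tau *: (x - a)], which lies in the cube of radius [r]. *)
  pose tau := r / rho; pose l := tau / (1 + tau).
  have tau0 : 0 < tau by rewrite divr_gt0.
  have l0 : 0 < l by rewrite divr_gt0// addr_gt0.
  have l1 : l <= 1 by rewrite ler_pdivrMr ?addr_gt0// mul1r lerDr.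
  exists ((f0 - (1 - l) * M) / l) => x xa.
  case E : (phi x) => [f| |]; [|exact: leey|by have := phiNy x; rewrite E].
  have xf : (phi x <= f%:E)%E by rewrite E.
  have uM : sublevel M (a - tau *: (x - a)).
    apply: arM => i; rewrite !mxE addrAC subrr add0r normrN normrM gtr0_norm//.
    by rewrite /tau mulrAC ltr_pdivrMr// ltr_pM2l//; exact: xa.
  have := convex_efun_le xf uM _ (t := l).
  rewrite (_ : l *: x + _ = a); last first.
    by apply/rowP => i; rewrite !mxE /l; field; rewrite gt_eqF// addr_gt0.
  rewrite Ea !lee_fin ltW//= => /(_ l1) h.
  by rewrite ler_pdivrMr// (mulrC f); lra.
pose C := 1 - Num.min M m + `|a| / rho.
have a0 : 0 <= `|a| / rho by rewrite divr_ge0// ltW.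
have mM : Num.min M m <= M /\ Num.min M m <= m by rewrite !ge_min !lexx orbT.
have cl (x : 'rV[R]_n) i : ((rho^-1 * `|x ord0 i| - C)%:E <= phi x)%E.
  have xi : rho^-1 * `|x ord0 i| <= `|x ord0 i - a ord0 i| / rho + `|a| / rho.
    rewrite mulrC -mulrDl ler_pM2r ?invr_gt0//.
    rewrite -[in leLHS](subrK (a ord0 i) (x ord0 i)) (le_trans (ler_normD _ _))// lerD2l.
    exact: ler_coord_norm.
  have [rd|rd] := leP rho `|x ord0 i - a ord0 i|.
    by apply: le_trans (far _ _ rd); rewrite lee_fin /C; case: mM; lra.
  have d1 : `|x ord0 i - a ord0 i| / rho <= 1 by rewrite ler_pdivrMr// mul1r ltW.
  have [xa|/existsNP[j /negP]] := pselect (cube a rho x).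
    by apply: le_trans (Hm _ xa); rewrite lee_fin /C; case: mM; lra.
  rewrite -leNgt => rj; apply: le_trans (far _ _ rj); rewrite lee_fin.
  have : 0 <= `|x ord0 j - a ord0 j| / rho by rewrite divr_ge0// ltW.
  by rewrite /C; case: mM; lra.
have lb x : ((- C)%:E <= phi x)%E.
  have [xa|/existsNP[j /negP]] := pselect (cube a rho x).
    by apply: le_trans (Hm _ xa); rewrite lee_fin /C; case: mM; lra.
  rewrite -leNgt => rj; apply: le_trans (far _ _ rj); rewrite lee_fin.
  have : 0 <= `|x ord0 j - a ord0 j| / rho by rewrite divr_ge0// ltW.
  by rewrite /C; case: mM; lra.
(* Average the bounds by the coordinates and the constant bound; thus [n.+1]. *)
exists (rho^-1 / n.+1%:R), C; split; first by rewrite divr_gt0// invr_gt0.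
move=> x; have := lb x; have := cl x.
case: (phi x) => [f| |] //; last by move=> _ _; exact: leey.
move=> clx; rewrite !lee_fin => lbx.
have : rho^-1 * norm1 x <= n%:R * (f + C).
  rewrite /norm1 mulr_sumr (_ : n%:R * _ = \sum_(i < n) (f + C)); last first.
    by rewrite sumr_const card_ord mulr_natl.
  by apply: ler_sum => i _; have := clx i; rewrite lee_fin lerBlDr.
rewrite lerBlDr mulrAC ler_pdivrMr// => /le_trans; apply.
by rewrite mulrC ler_wpM2l ?ler_nat//; lra.
Qed.

(** Prolong the segment from [a] to [z] a little beyond [z], inside the domain. *)
Lemma interior_edom_sublevel a r M z : 0 < r -> cube a r `<=` sublevel M ->
  interior [set x | (phi x < +oo)%E] z ->
  exists M', exists2 r' : R, 0 < r' & cube z r' `<=` sublevel M'.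
Proof.
move=> r0 arM /nbhs_cubeP[s s0 zs].
have N0 : 0 < `|z - a| + 1 by rewrite ltr_wpDl.
pose e := s / (`|z - a| + 1).
have e0 : 0 < e by rewrite divr_gt0.
have [|b zb] := @edom_sublevel (z + e *: (z - a)).
  apply: zs => i; rewrite !mxE addrAC subrr add0r normrM gtr0_norm//.
  rewrite /e mulrAC ltr_pdivrMr// ltr_pM2l// ltr_pwDr//.
  by have := ler_coord_norm (z - a) i; rewrite !mxE.
pose t := (1 + e)^-1.
have t01 : 0 <= t < 1 by rewrite invf_lt1 ?addr_gt0// ltrDl e0 invr_ge0 ltW// addr_gt0.
exists (Num.max M b), ((1 - t) * r).
  by rewrite mulr_gt0// subr_gt0; case/andP: t01.
rewrite [X in cube X](_ : z = t *: (z + e *: (z - a)) + (1 - t) *: a).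
  apply: (convex_cube_star (@convex_sublevel _)) => //.
    by apply: subset_trans arM _; apply: sublevelS; rewrite le_max lexx.
  by apply: sublevelS zb; rewrite le_max lexx orbT.
by apply/rowP => i; rewrite !mxE /t; field; rewrite gt_eqF// addr_gt0.
Qed.

End convex_functions.

(** * Minimization of a Laplace transform *)

Section exponential_inequalities.
Context {R : realType}.
Implicit Types x : R.

Lemma expR_ge1 x : 0 <= x -> 1 <= expR x.
Proof. by move=> x0; apply: le_trans (expR_ge1Dx x); rewrite lerDl. Qed.

Lemma expR_half_sqr x : expR x = expR (x / 2) ^+ 2.
Proof. by rewrite expr2 -expRD; congr expR; field. Qed.

Lemma expR_le_quadratic x : expR x <= 1 + x + x ^+ 2 * expR `|x|.
Proof.
have h1 : expR x * (1 - x) <= 1.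
  rewrite -[leRHS](expRxMexpNx_1 x) ler_wpM2l ?expR_ge0//; exact: expR_ge1Dx.
have h2 := expR_ge1Dx x.
have [x0|x0] := leP 0 x.
  rewrite ger0_norm// expr2 -mulrA.
  have : x * (expR x * (1 - x)) <= x * 1 by rewrite ler_wpM2l.
  by nra.
have e1 : 1 <= expR `|x| by rewrite expR_ge1.
have : x ^+ 2 * 1 <= x ^+ 2 * expR `|x| by rewrite ler_wpM2l// sqr_ge0.
by nra.
Qed.

Lemma sqr_le_expR x (r : R) : 0 < r -> x ^+ 2 <= 4 / r ^+ 2 * expR (r * `|x|).
Proof.
move=> r0; rewrite -ler_pdivrMl ?divr_gt0// ?exprn_gt0//.
rewrite expR_half_sqr.
rewrite (_ : _ * x ^+ 2 = (r * `|x| / 2) ^+ 2); last first.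
  by rewrite !exprMn real_normK ?num_real//; field; rewrite gt_eqF.
rewrite ler_sqr ?nnegrE ?expR_ge0//; last by rewrite divr_ge0// mulr_ge0// ltW.
by apply: le_trans (expR_ge1Dx _); rewrite lerDr.
Qed.

Lemma linear_quadratic_eq0 (m K d : R) : 0 < d -> 0 <= K ->
  (forall t, `|t| <= d -> 0 <= t * m + t ^+ 2 * K) -> m = 0.
Proof.
move=> d0 K0 h; apply/eqP; rewrite -normr_le0 leNgt; apply/negP => m0.
(* At this [t], with the sign opposite to that of [m], the linear term dominates. *)
pose t := Num.min d (`|m| / (2 * (K + 1))).
have K1 : 0 < 2 * (K + 1) by lra.
have t0 : 0 < t by rewrite lt_min d0 divr_gt0.
have td : t <= d by rewrite ge_min lexx.
have tm : t * (2 * (K + 1)) <= `|m|.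
  by rewrite -ler_pdivlMr// ge_min lexx orbT.
have := h (- Num.sg m * t); rewrite normrM normrN normr_sg.
have m00 : m != 0 by rewrite -normr_gt0.
rewrite m00 mul1r gtr0_norm// => /(_ td).
rewrite exprMn sqrrN sqr_sg m00 mul1r.
rewrite (_ : _ * m = - (t * `|m|)); last by rewrite [in RHS]normrEsg; ring.
move=> h2.
have : t * (t * (2 * (K + 1))) <= t * `|m| by rewrite ler_pM2l.
have : 0 < t * t by rewrite mulr_gt0.
have : 0 < t * `|m| by rewrite mulr_gt0.
by nra.
Qed.

End exponential_inequalities.

Section laplace_transform.
Context {R : realType} {n : nat} (w : 'rV[R]_n -> R).
Hypothesis mw : measurable_fun setT w.
Hypothesis w0 : forall y, 0 <= w y.

Definition laplace (z : 'rV[R]_n) : \bar R :=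
  (\int[lebesgue_rV n]_y (expR (dotp z y) * w y)%:E)%E.

Lemma measurable_laplace z : measurable_fun setT (fun y => expR (dotp z y) * w y).
Proof.
apply: measurable_funM => //; apply: measurableT_comp => //.
exact: measurable_dotp.
Qed.

Lemma laplace_integrand_ge0 z y : 0 <= expR (dotp z y) * w y.
Proof. by rewrite mulr_ge0// expR_ge0. Qed.

Lemma laplace_ge0 z : (0 <= laplace z)%E.
Proof. by apply: integral_ge0 => y _; rewrite lee_fin laplace_integrand_ge0. Qed.

Lemma laplace_lsc (u : nat -> 'rV[R]_n) l m :
  (forall j, cube l j.+1%:R^-1 (u j)) -> laplace (u j) @[j --> \oo] --> m ->
  (laplace l <= m)%E.
Proof.
move=> ul um.
have [<- _] := cvg_limn_einf_sup um.
apply: le_trans (fatou _ _ _ _) => //; last 2 first.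
- by move=> j; apply/measurable_EFinP; exact: measurable_laplace.
- by move=> j y _; rewrite lee_fin laplace_integrand_ge0.
rewrite le_eqVlt; apply/orP; left; apply/eqP; apply: eq_integral => y _.
apply/esym; apply: (fun h => (cvg_limn_einf_sup h).1).
apply: cvg_EFin; first exact: nearW.
rewrite /comp /=; apply: cvgMl.
apply: continuous_cvg; first exact: continuous_expR.
apply/cvgrPdist_le => e e0.
have uly j : `|dotp l y - dotp (u j) y| <= j.+1%:R^-1 * norm1 y.
  rewrite distrC -dotpBl dotpC.
  by apply: ler_dotp_norm1 => i; rewrite !mxE subr0; exact: ul.
have [y0|y0] := leP (norm1 y) 0.
  apply: nearW => j; apply: (le_trans (uly j)).
  by apply: (@le_trans _ _ 0); [rewrite pmulr_rle0|exact: ltW].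
near=> j; apply: (le_trans (uly j)).
rewrite -ler_pdivlMr//; apply/ltW; near: j.
exact: near_infty_natSinv_lt (PosNum (divr_gt0 e0 y0)).
Unshelve. all: by end_near. Qed.

Section lower_bound.
Variables (c r : R).
Hypotheses (c0 : 0 < c) (r0 : 0 < r).
Hypothesis wc : forall y, cube 0 r y -> c <= w y.

(** Integrate over the corner of the cube where [dotp z] is large. *)
Lemma laplace_coercive z :
  ((c * (2 * (r / 4)) ^+ n * expR (r / 4 * norm1 z))%:E <= laplace z)%E.
Proof.
have [b br bz] := corner_cube z r0.
rewrite mulrAC; apply: (@le_integralT_cube _ _ _ b).
- by apply/measurable_EFinP; exact: measurable_laplace.
- by move=> y; rewrite lee_fin laplace_integrand_ge0.
- by rewrite divr_ge0// ltW.
- move=> y yb; rewrite lee_fin mulrC ler_pM ?expR_ge0 ?(ltW c0)//; last exact/wc/br.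
  by rewrite ler_expR; exact: bz.
Qed.

Lemma laplace_gt0 z : (0 < laplace z)%E.
Proof.
apply: lt_le_trans (laplace_coercive z); rewrite lte_fin.
by rewrite !mulr_gt0 ?expR_gt0// exprn_gt0// mulr_gt0// divr_gt0.
Qed.

(** At the midpoint [u], the mean of [exp (dotp z y)] and [exp (dotp z' y)] exceeds
    [exp (dotp u y)] by half of the square [(exp (dotp z y / 2) - exp (dotp z' y / 2)) ^+ 2],
    which is bounded below on a corner cube if [z] differs from [z']. *)
Lemma laplace_minimizer_unique z z' : (laplace z < +oo)%E ->
  laplace z' = laplace z -> (forall u, (laplace z <= laplace u)%E) -> z = z'.
Proof.
move=> zoo /eqP zz' zmin; apply/eqP; rewrite -subr_eq0; apply: contraT => /norm1_gt0 nv0.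
pose u := 2^-1 *: (z + z').
pose D y := (expR (dotp z y / 2) - expR (dotp z' y / 2)) ^+ 2 * w y.
have D0 y : 0 <= D y by rewrite mulr_ge0// sqr_ge0.
have mD : measurable_fun setT D.
  apply: measurable_funM => //; apply: measurable_funX; apply: measurable_funB;
    by apply: measurableT_comp => //; apply: measurable_funM => //; exact: measurable_dotp.
have split_u y : expR (dotp z y) * w y + expR (dotp z' y) * w y =
    2 * (expR (dotp u y) * w y) + D y.
  rewrite /D /u dotpZl dotpDl.
  rewrite (expR_half_sqr (dotp z y)) (expR_half_sqr (dotp z' y)).
  have -> : expR (2^-1 * (dotp z y + dotp z' y)) = expR (dotp z y / 2) * expR (dotp z' y / 2).
    by rewrite -expRD; congr expR; field.
  by ring.
have sumE : (laplace z + laplace z' = 2%:E * laplace u + \int[lebesgue_rV n]_y (D y)%:E)%E.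
  rewrite /laplace -ge0_integralZl_EFin//; last 2 first.
  - by move=> y _; rewrite lee_fin laplace_integrand_ge0.
  - by apply/measurable_EFinP; exact: measurable_laplace.
  rewrite -!ge0_integralD//=.
  - by apply: eq_integral => y _; rewrite -EFinD split_u.
  - by move=> y _; rewrite lee_fin mulr_ge0// laplace_integrand_ge0.
  - by apply: measurable_funeM; apply/measurable_EFinP; exact: measurable_laplace.
  - by move=> y _; rewrite lee_fin.
  - exact/measurable_EFinP.
  - by move=> y _; rewrite lee_fin laplace_integrand_ge0.
  - by apply/measurable_EFinP; exact: measurable_laplace.
  - by move=> y _; rewrite lee_fin laplace_integrand_ge0.
  - by apply/measurable_EFinP; exact: measurable_laplace.
have [b br bz] := corner_cube (z - z') r0.
pose d := r / 4 * norm1 (z - z').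
have d0 : 0 < d by rewrite mulr_gt0 ?divr_gt0.
pose k := expR (- (r * norm1 z')) * (d / 2) ^+ 2 * c.
have k0 : 0 < k.
  by rewrite mulr_gt0// mulr_gt0 ?expR_gt0//; apply: exprn_gt0; rewrite divr_gt0.
have Dk : ((k * (2 * (r / 4)) ^+ n)%:E <= \int[lebesgue_rV n]_y (D y)%:E)%E.
  apply: (@le_integralT_cube _ _ _ b).
  - exact/measurable_EFinP.
  - by move=> y; rewrite lee_fin.
  - by rewrite divr_ge0// ltW.
  - move=> y yb; rewrite lee_fin /D /k; apply: ler_pM; [|exact: ltW| |exact/wc/br].
      by apply: mulr_ge0; [exact: expR_ge0|exact: sqr_ge0].
    have yr := br _ yb.
    have -> : expR (dotp z y / 2) - expR (dotp z' y / 2) =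
        expR (dotp z' y / 2) * (expR (dotp (z - z') y / 2) - 1).
      by rewrite mulrBr mulr1 -expRD dotpBl; congr (expR _ - _); field.
    rewrite [leRHS]exprMn; apply: ler_pM; [exact: expR_ge0|exact: sqr_ge0| |].
      rewrite -expR_half_sqr ler_expR.
      have := ler_dotp_norm1 z' yr; by rewrite ler_norml => /andP[].
    have dz := bz _ yb; rewrite -/d in dz.
    have := expR_ge1Dx (dotp (z - z') y / 2) => h.
    by rewrite ler_sqr ?nnegrE; lra.
have : (0 < \int[lebesgue_rV n]_y (D y)%:E)%E.
  apply: lt_le_trans Dk; rewrite lte_fin; apply: mulr_gt0 => //.
  by apply: exprn_gt0; rewrite mulr_gt0// divr_gt0.
have zfin : laplace z \is a fin_num by rewrite ge0_fin_numE// laplace_ge0.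
have := zmin u; move: sumE; rewrite (eqP zz'); move: zfin {zz'}.
case: (\int[_]_y (D y)%:E)%E => [i| |] //; case: (laplace z) => [g| |] //.
  case: (laplace u) => [h| |] //; last by rewrite mulry gtr0_sg// mul1e.
  by move=> _; rewrite -EFinM -!EFinD => -[] ghi; rewrite lee_fin lte_fin; lra.
move=> _ sumE gu; move: sumE; rewrite addey// gt_eqF//.
by rewrite (lt_le_trans _ (mule_ge0 _ (laplace_ge0 u))).
Qed.

Lemma laplace_minimizer_exists z0 : (laplace z0 < +oo)%E ->
  exists2 s, (laplace s < +oo)%E & forall u, (laplace s <= laplace u)%E.
Proof.
move=> z0oo.
pose m := ereal_inf (range laplace).
have m0 : (0 <= m)%E by apply: le_ereal_inf_tmp => _ [z _ <-]; exact: laplace_ge0.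
have mle u : (m <= laplace u)%E by apply: ereal_inf_lbound; exists u.
have mfin : m \is a fin_num by rewrite ge0_fin_numE// (le_lt_trans (mle z0)).
have /choice[z zm] : forall k : nat, exists z, (laplace z < m + (k.+1%:R^-1)%:E)%E.
  move=> k; have k0 : 0 < k.+1%:R^-1 :> R by [].
  by have [_ [z _ <-] h] := lb_ereal_inf_adherent k0 mfin; exists z.
pose a := c * (2 * (r / 4)) ^+ n.
have a0 : 0 < a by rewrite mulr_gt0// exprn_gt0// mulr_gt0// divr_gt0.
pose B := (fine m + 1) / a / (r / 4).
have [l lz] : exists l, forall j, exists2 k, (j <= k)%N & cube l j.+1%:R^-1 (z k).
  apply: (@bounded_seq_cluster _ _ _ B) => k i.
  have : (a * expR (r / 4 * norm1 (z k)) <= fine m + 1).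
    rewrite -lee_fin; apply: (le_trans (laplace_coercive _)).
    apply: (le_trans (ltW (zm k))); rewrite EFinD fineK// leeD2l// lee_fin.
    by rewrite invf_le1// ler1n.
  rewrite mulrC -ler_pdivlMr// => h.
  apply: (@le_trans _ _ (norm1 (z k))).
    by rewrite /norm1 (bigD1 i)//= lerDl sumr_ge0.
  rewrite /B ler_pdivlMr ?divr_gt0//; apply: le_trans h.
  by apply: le_trans (expR_ge1Dx _); rewrite mulrC lerDr.
have /choice[u uP] : forall j, exists u, cube l j.+1%:R^-1 u /\
    (laplace u <= m + (j.+1%:R^-1)%:E)%E.
  move=> j; have [k jk lk] := lz j; exists (z k); split => //.
  apply: (le_trans (ltW (zm k))); rewrite leeD2l// lee_fin.
  by rewrite lef_pV2 ?posrE// ler_nat.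
have lm : (laplace l <= m)%E.
  apply: (@laplace_lsc u); first by move=> j; case: (uP j).
  apply: (@squeeze_cvge _ _ _ _ (cst m) _ (fun j => m + (j.+1%:R^-1)%:E)%E).
  - by apply: nearW => j; rewrite mle/=; case: (uP j).
  - exact: cvg_cst.
  rewrite -[X in _ --> X]adde0; apply: cvgeD.
  - by rewrite fin_num_adde_defl.
  - exact: cvg_cst.
  - by apply: cvg_EFin; [exact: nearW|exact: cvg_harmonic].
exists l => [|u']; first by rewrite (le_lt_trans lm)// (le_lt_trans (mle z0)).
exact: le_trans lm (mle _).
Qed.

End lower_bound.

(** The exponential lies above its tangent at [dotp z y], and the linear terms integrate to 0. *)
Lemma laplace_critical_minimizer z : (laplace z < +oo)%E ->
  (forall i, (lebesgue_rV n).-integrable setT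
     (fun y => (y ord0 i * (expR (dotp z y) * w y))%:E)) ->
  (forall i, \int[lebesgue_rV n]_y (y ord0 i * (expR (dotp z y) * w y))%:E = 0)%E ->
  forall u, (laplace z <= laplace u)%E.
Proof.
move=> zoo iz z0 u.
have [uoo|] := ltP (laplace u) +oo%E; last by rewrite leye_eq => /eqP ->; exact: leey.
have il v : (laplace v < +oo)%E ->
    (lebesgue_rV n).-integrable setT (fun y => (expR (dotp v y) * w y)%:E).
  move=> voo; apply/integrableP; split.
    by apply/measurable_EFinP; exact: measurable_laplace.
  under eq_integral do rewrite gee0_abs ?lee_fin ?laplace_integrand_ge0//.
  exact: voo.
pose S (y : 'rV[R]_n) := (\sum_(i < n)
  (((u - z) ord0 i)%:E * (y ord0 i * (expR (dotp z y) * w y))%:E))%E.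
have iS : (lebesgue_rV n).-integrable setT S.
  by apply: integrable_sum => // i _; apply: integrableZl.
have S0 : (\int[lebesgue_rV n]_y S y = 0)%E.
  rewrite /S integral_sum//; last by move=> i; apply: integrableZl.
  by rewrite big1// => i _; rewrite integralZl// z0 mule0.
have -> : laplace z = (\int[lebesgue_rV n]_y ((expR (dotp z y) * w y)%:E + S y))%E.
  by rewrite integralD//; [rewrite S0 adde0|exact: il].
apply: le_integral => //; [|exact: il|].
  by apply: integrableD => //; exact: il.
move=> y _; rewrite /S.
under eq_bigr do rewrite -EFinM.
rewrite sumEFin -EFinD lee_fin.
rewrite (_ : \sum_(i < n) _ = dotp (u - z) y * (expR (dotp z y) * w y)); last first.
  by rewrite /dotp mulr_suml; apply: eq_bigr => i _; rewrite !mulrA.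
have -> : expR (dotp u y) = expR (dotp z y) * expR (dotp (u - z) y).
  by rewrite -expRD dotpBl; congr expR; ring.
rewrite -{1}[_ * w y]mul1r -mulrDl mulrAC mulrC ler_wpM2l ?laplace_integrand_ge0//.
exact: expR_ge1Dx.
Qed.

(** Perturb [s] by [t] along coordinate [i]: the integrand changes by [t] times that of
    the moment, up to [t ^+ 2] times a function that the exponential integrability
    controls.  Minimality for both signs of [t] forces the moment to vanish. *)
Lemma laplace_minimizer_critical s rho : 0 < rho ->
  (\int[lebesgue_rV n]_y (expR (rho * norm1 y) * (expR (dotp s y) * w y))%:E < +oo)%E ->
  (forall u, (laplace s <= laplace u)%E) ->
  forall i, (lebesgue_rV n).-integrable setT
     (fun y => (y ord0 i * (expR (dotp s y) * w y))%:E) /\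
  (\int[lebesgue_rV n]_y (y ord0 i * (expR (dotp s y) * w y))%:E = 0)%E.
Proof.
move=> rho0 Koo smin i.
pose h (y : 'rV[R]_n) := expR (dotp s y) * w y.
pose H (y : 'rV[R]_n) := expR (rho * norm1 y) * h y.
have h0 y : 0 <= h y by exact: laplace_integrand_ge0.
have mh : measurable_fun setT h by exact: measurable_laplace.
have mH : measurable_fun setT H.
  apply: measurable_funM => //; apply: measurableT_comp => //.
  by apply: measurable_funM => //; exact: measurable_norm1.
have H0 y : 0 <= H y by rewrite mulr_ge0// expR_ge0.
have iH : (lebesgue_rV n).-integrable setT (EFin \o H).
  apply/integrableP; split; first exact/measurable_EFinP.
  by under eq_integral do rewrite gee0_abs ?lee_fin//.
have yi (y : 'rV[R]_n) : `|y ord0 i| <= norm1 y by rewrite /norm1 (bigD1 i)//= lerDl sumr_ge0.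
have ih : (lebesgue_rV n).-integrable setT (EFin \o h).
  apply: le_integrable iH => //; first exact/measurable_EFinP.
  move=> y _; rewrite /= lee_fin !ger0_norm// ler_peMl//; apply: expR_ge1.
  by rewrite mulr_ge0 ?norm1_ge0// ltW.
have iyh : (lebesgue_rV n).-integrable setT (fun y => (y ord0 i * h y)%:E).
  have := integrableZl measurableT rho^-1 iH; apply: le_integrable => //.
    apply/measurable_EFinP; apply: measurable_funM => //; exact: measurable_coord_rV.
  move=> y _; rewrite -EFinM lee_fin [leRHS]ger0_norm ?mulr_ge0 ?invr_ge0 ?(ltW rho0)//.
  rewrite normrM (ger0_norm (h0 y)) /H [leRHS]mulrA ler_wpM2r// ler_pdivlMl//.
  apply: (@le_trans _ _ (rho * norm1 y)); first by rewrite ler_pM2l.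
  by apply: le_trans (expR_ge1Dx _); rewrite lerDr.
split => //.
have ifin : (\int[lebesgue_rV n]_y (y ord0 i * h y)%:E \is a fin_num)%E.
  exact: integrable_fin_num.
rewrite -(fineK ifin); congr EFin.
pose K := 4 / (rho / 2) ^+ 2 * fine (\int[lebesgue_rV n]_y (H y)%:E)%E.
have K0 : 0 <= K.
  rewrite mulr_ge0// ?divr_ge0 ?sqr_ge0//; apply: fine_ge0.
  by apply: integral_ge0 => y _; rewrite lee_fin.
apply: (@linear_quadratic_eq0 _ _ K (rho / 2)) => //; first by rewrite divr_gt0.
move=> t td.
pose C := 4 / (rho / 2) ^+ 2.
have iC : (lebesgue_rV n).-integrable setT (fun y => (t ^+ 2 * C)%:E * (H y)%:E)%E.
  exact: integrableZl.
have iT : (lebesgue_rV n).-integrable setT (fun y => t%:E * (y ord0 i * h y)%:E)%E.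
  exact: integrableZl.
have Hfin : (\int[lebesgue_rV n]_y (H y)%:E)%E \is a fin_num.
  exact: integrable_fin_num.
have hfin : (\int[lebesgue_rV n]_y (h y)%:E)%E \is a fin_num.
  exact: integrable_fin_num.
have : (laplace s <= \int[lebesgue_rV n]_y ((h y)%:E +
     (t%:E * (y ord0 i * h y)%:E + (t ^+ 2 * C)%:E * (H y)%:E)))%E.
  apply: (le_trans (smin (s + t *: delta_mx ord0 i))).
  apply: ge0_le_integral => //.
  - by move=> y _; rewrite lee_fin laplace_integrand_ge0.
  - by apply/measurable_EFinP; exact: measurable_laplace.
  - apply: (measurable_int (lebesgue_rV n)); apply: integrableD => //.
    exact: integrableD.
  move=> y _; rewrite -!EFinM -!EFinD lee_fin.
  have -> : dotp (s + t *: delta_mx ord0 i) y = dotp s y + t * y ord0 i.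
    rewrite dotpDl dotpZl; congr (_ + _ * _).
    rewrite /dotp (bigD1 i)//= mxE !eqxx mul1r big1 ?addr0// => j ji.
    by rewrite mxE (negbTE ji) andbF mul0r.
  rewrite expRD mulrAC -/(h y) mulrC.
  have := expR_le_quadratic (t * y ord0 i).
  set x := t * y ord0 i => xq.
  have xH : x ^+ 2 * expR `|x| <= t ^+ 2 * C * expR (rho * norm1 y).
    rewrite /x exprMn -(mulrA (t ^+ 2) C) -(mulrA (t ^+ 2) _ (expR _)).
    apply: ler_wpM2l; first exact: sqr_ge0.
    have xr : `|t * y ord0 i| <= rho / 2 * norm1 y.
      by rewrite normrM ler_pM.
    have -> : expR (rho * norm1 y) = expR (rho / 2 * norm1 y) * expR (rho / 2 * norm1 y).
      by rewrite -expRD; congr expR; field.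
    rewrite mulrA; apply: ler_pM; rewrite ?expR_ge0 ?ler_expR//; first exact: sqr_ge0.
    apply: (le_trans (@sqr_le_expR _ _ (rho / 2) _)); first by rewrite divr_gt0.
    apply: ler_wpM2l; first by rewrite divr_ge0// exprn_ge0// divr_ge0// ltW.
    by rewrite ler_expR; apply: ler_wpM2l => //; rewrite divr_ge0// ltW.
  apply: (@le_trans _ _ ((1 + x + t ^+ 2 * C * expR (rho * norm1 y)) * h y)).
    by rewrite ler_wpM2r//; lra.
  by rewrite /H /x le_eqVlt; apply/orP; left; apply/eqP; ring.
rewrite integralD//; last exact: integrableD.
rewrite integralD// integralZl// integralZl//.
rewrite /laplace -/(h _) -[X in (X <= _)%E](fineK hfin) -[X in (X + _)%E](fineK hfin).
rewrite -(fineK ifin) -(fineK Hfin) -!EFinM -!EFinD lee_fin.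
by rewrite lerDl /K -/C (mulrA (t ^+ 2) C).
Qed.

End laplace_transform.

(** * The transform of a translate *)

Section inverse_root.
Context {R : realType} (p : R).
Hypothesis p0 : 0 < p.

(** The power [L `^ (- p^-1)], with value 0 at [L = +oo]; this form is the one in which
    it occurs in [expeR (- Lp_legendre p _ _)]. *)
Definition inv_root (L : \bar R) : R := fine (expeR (- ((p^-1)%:E * lne L))%E).

Lemma inv_rootE (L : \bar R) : (0 < L)%E ->
  expeR (- ((p^-1)%:E * lne L))%E = (inv_root L)%:E.
Proof.
move=> L0; rewrite /inv_root; case: L L0 => [r| |] // r0.
  by rewrite lne_EFin.
by rewrite /= mulry gtr0_sg ?invr_gt0// mul1e.
Qed.

Lemma inv_root_ge0 (L : \bar R) : 0 <= inv_root L.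
Proof. by apply: fine_ge0; exact: expeR_ge0. Qed.

Lemma inv_root_scale b (L : \bar R) : (0 < L)%E ->
  inv_root ((expR (p * b))%:E * L)%E = expR (- b) * inv_root L.
Proof.
rewrite /inv_root; case: L => [r| |] // r0.
  rewrite -EFinM !lne_EFin//; last by rewrite mulr_gt0// expR_gt0.
  rewrite lnM ?posrE ?expR_gt0// expRK /= -expRD; congr expR.
  by field; rewrite gt_eqF.
by rewrite mulry gtr0_sg ?expR_gt0// mul1e /= mulry gtr0_sg ?invr_gt0// mul1e/= mulr0.
Qed.

Lemma inv_root_expR b : inv_root (expR (p * b))%:E = expR (- b).
Proof.
rewrite -[X in inv_root X]mule1 inv_root_scale ?lte_fin// /inv_root.
by rewrite lne1 mule0 oppe0 expeR0 mulr1.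
Qed.

Lemma inv_root_le (L L' : \bar R) : (0 < L)%E -> (L <= L')%E ->
  inv_root L' <= inv_root L.
Proof.
move=> L0 LL'; have L'0 := lt_le_trans L0 LL'.
rewrite -lee_fin -!inv_rootE// lee_expeR leeN2.
rewrite lee_pmul2l// ?lte_fin ?invr_gt0//.
by rewrite lee_lne// in_itv/= ?leey ?ltW.
Qed.

Lemma measurable_inv_root : measurable_fun setT inv_root.
Proof.
apply: measurableT_comp; first exact: fine_measurable.
apply: measurableT_comp; first exact: measurable_expeR.
apply: measurableT_comp => //.
by apply: measurable_funeM; exact: measurable_lne.
Qed.

End inverse_root.

Section Lp_legendre_laplace.
Context {R : realType} {n : nat} (p : R) (phi : 'rV[R]_n -> \bar R).
Hypothesis p0 : 0 < p.
Hypothesis Cphi : Cvx phi.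

Let phiNy x : phi x != -oo%E.
Proof. by case: Cphi => -[]. Qed.

Let cphi : convex_efun phi.
Proof. by case: Cphi. Qed.

Let mphi : measurable_fun setT phi.
Proof. by apply: lower_semicontinuous_measurable_rV; case: Cphi. Qed.

Let v := fine (vol phi).

Let vE : vol phi = v%:E.
Proof. by case: Cphi => _ _ _ /andP[V0 Voo]; rewrite fineK// gt0_fin_numE. Qed.

Let v0 : 0 < v.
Proof. by case: Cphi => _ _ _ /andP[V0 Voo]; rewrite -lte_fin -vE. Qed.

(** The density [exp (- (p + 1) * phi x) / vol phi], as a real function; it vanishes off
    the domain of [phi]. *)
Definition tilt (x : 'rV[R]_n) : R :=
  fine (expeR (p%:E * - phi x) * expeR (- phi x))%E / fine (vol phi).

Definition mgf (y : 'rV[R]_n) : \bar R :=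
  (\int[lebesgue_rV n]_x (expR (p * dotp x y) * tilt x)%:E)%E.

Definition dual_weight (y : 'rV[R]_n) : R := inv_root p (mgf y).

Lemma tilt_ge0 x : 0 <= tilt x.
Proof. by rewrite divr_ge0// ?(ltW v0)// fine_ge0// mule_ge0// expeR_ge0. Qed.

Lemma measurable_expeRN : measurable_fun setT (fun x => expeR (- phi x)%E).
Proof.
by apply: measurableT_comp; [exact: measurable_expeR|exact: measurableT_comp].
Qed.

Lemma measurable_tilt : measurable_fun setT tilt.
Proof.
apply: measurable_funM => //; apply: measurableT_comp; first exact: fine_measurable.
apply: emeasurable_funM; last exact: measurable_expeRN.
apply: measurableT_comp; first exact: measurable_expeR.
by apply: measurable_funeM; exact: measurableT_comp.
Qed.

Lemma tilt_pinfty x : phi x = +oo%E -> tilt x = 0.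
Proof. by rewrite /tilt => ->; rewrite mulrNy gtr0_sg// mul1e/= mulr0 mul0r. Qed.

Lemma tilt_fin x s : phi x = s%:E -> tilt x = expR (- (p * s)) * expR (- s) / v.
Proof. by rewrite /tilt => -> /=; rewrite mulrN. Qed.

Lemma tilt_sublevel M x : sublevel phi M x ->
  expR (- (p * M)) * expR (- M) / v <= tilt x.
Proof.
rewrite /sublevel/=; case E : (phi x) => [s| |]; rewrite ?leye_eq//.
  rewrite lee_fin => sM; rewrite (tilt_fin E) ler_pM2r ?invr_gt0//.
  by rewrite ler_pM ?expR_ge0// ler_expR lerN2// ler_pM2l.
by have := phiNy x; rewrite E.
Qed.

Lemma measurable_mgf_integrand y :
  measurable_fun setT (fun x => expR (p * dotp x y) * tilt x).
Proof.
apply: measurable_funM; last exact: measurable_tilt.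
apply: measurableT_comp => //; apply: measurable_funM => //.
under eq_fun do rewrite dotpC; exact: measurable_dotp.
Qed.

Lemma mgf_integrand_ge0 x y : 0 <= expR (p * dotp x y) * tilt x.
Proof. by rewrite mulr_ge0 ?expR_ge0 ?tilt_ge0. Qed.

Lemma measurable_mgf : measurable_fun setT mgf.
Proof.
apply: (measurable_fun_fubini_tonelli_F
  (fun yx : 'rV[R]_n * 'rV[R]_n => (expR (p * dotp yx.2 yx.1) * tilt yx.2)%:E)).
- apply/measurable_EFinP; apply: measurable_funM; last first.
    by apply: measurableT_comp; [exact: measurable_tilt|exact: measurable_snd].
  apply: measurableT_comp => //; apply: measurable_funM => //.
  apply: measurable_sum => i; apply: measurable_funM.
    by apply: (measurableT_comp (@measurable_coord_rV R n i)); exact: measurable_snd.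
  by apply: (measurableT_comp (@measurable_coord_rV R n i)); exact: measurable_fst.
- by move=> yx; rewrite lee_fin mgf_integrand_ge0.
Qed.

Lemma measurable_dual_weight : measurable_fun setT dual_weight.
Proof.
by apply: (measurableT_comp (measurable_inv_root p)); exact: measurable_mgf.
Qed.

Lemma vol_translate z : vol (translate z phi) = vol phi.
Proof.
rewrite /vol /translate.
apply: (ge0_integral_shift_rV (f := fun x => expeR (- phi x)%E)).
  exact: measurable_expeRN.
by move=> x; exact: expeR_ge0.
Qed.

(** Integrate over the corner of the cube where [dotp (x - z) y] is large. *)
Lemma cube_sublevel_mgf z r M : 0 < r -> cube z r `<=` sublevel phi M ->
  exists k, forall y,
    ((expR (p * (dotp z y + r / 4 * norm1 y + k)))%:E <= mgf y)%E.
Proof.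
move=> r0 zM.
pose a := expR (- (p * M)) * expR (- M) / v * (2 * (r / 4)) ^+ n.
have a0 : 0 < a.
  apply: mulr_gt0; last by apply: exprn_gt0; rewrite mulr_gt0// divr_gt0.
  by rewrite divr_gt0// mulr_gt0 ?expR_gt0.
exists (ln a / p) => y.
have [b br bnorm] := corner_cube y r0.
rewrite (_ : expR _ = expR (p * (dotp z y + r / 4 * norm1 y)) *
    (expR (- (p * M)) * expR (- M) / v) * (2 * (r / 4)) ^+ n); last first.
  rewrite -[RHS]mulrA -/a mulrDr expRD (_ : p * (ln a / p) = ln a).
    by rewrite lnK.
  by field; rewrite gt_eqF.
apply: (@le_integralT_cube _ _ _ (z + b) (r / 4)).
- by apply/measurable_EFinP; exact: measurable_mgf_integrand.
- by move=> x; rewrite lee_fin mgf_integrand_ge0.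
- by rewrite divr_ge0// ltW.
move=> x xzb.
have xb : cube b (r / 4) (x - z).
  by move=> i; have := xzb i; rewrite !mxE opprD addrA.
have xz : cube z r x by move=> i; have := br _ xb i; rewrite !mxE subr0.
rewrite lee_fin; apply: ler_pM; [exact: expR_ge0| | |exact/tilt_sublevel/zM].
  by rewrite divr_ge0 ?(ltW v0)// mulr_ge0 ?expR_ge0.
rewrite ler_expR ler_pM2l// -(subrK z x) dotpDl addrC lerD2r.
by rewrite dotpC; exact: bnorm.
Qed.

Lemma sublevel_cube : exists M a, exists2 r : R, 0 < r & cube a r `<=` sublevel phi M.
Proof.
by apply: vol_gt0_sublevel_cube => //; case: Cphi => _ _ _ /andP[].
Qed.

Lemma mgf_gt0 y : (0 < mgf y)%E.
Proof.
have [M [a [r r0 arM]]] := sublevel_cube.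
have [k kP] := cube_sublevel_mgf r0 arM.
by apply: lt_le_trans (kP y); rewrite lte_fin expR_gt0.
Qed.

Lemma dual_weight_ge0 y : 0 <= dual_weight y.
Proof. exact: inv_root_ge0. Qed.

Lemma Lp_legendre_translate z y :
  Lp_legendre p (translate z phi) y =
  ((p^-1)%:E * lne ((expR (p * - dotp z y))%:E * mgf y))%E.
Proof.
rewrite /Lp_legendre vol_translate; congr (_ * lne _)%E.
pose F (x : 'rV[R]_n) := (expR (p * dotp (x - z) y) * tilt x)%:E.
have FE x : F x = ((expR (p * - dotp z y))%:E * (expR (p * dotp x y) * tilt x)%:E)%E.
  rewrite /F -EFinM [in RHS]mulrA -expRD dotpBl.
  by congr (expR _ * _)%:E; ring.
transitivity (\int[lebesgue_rV n]_x F (x + z)%R)%E.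
  apply: eq_integral => x _; rewrite /F addrK /translate.
  case E : (phi (x + z)%R) => [s| |].
  - rewrite (tilt_fin E) vE inver gt_eqF// -EFinB -!EFinM /=.
    by rewrite !mulrA -expRD; congr (expR _ * _ * _)%:E; ring.
  - by rewrite (tilt_pinfty E) mulr0 addeNy mulrNy gtr0_sg// mul1e/= mul0e.
  - by have := phiNy (x + z); rewrite E.
rewrite (ge0_integral_shift_rV (f := F)).
- under eq_integral do rewrite FE.
  rewrite ge0_integralZl_EFin//.
  + by move=> x _; rewrite lee_fin mgf_integrand_ge0.
  + by apply/measurable_EFinP; exact: measurable_mgf_integrand.
- rewrite (funext FE).
  apply: measurable_funeM; apply/measurable_EFinP; exact: measurable_mgf_integrand.
- by move=> x; rewrite lee_fin mulr_ge0 ?expR_ge0 ?tilt_ge0.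
Qed.

Lemma expeR_Lp_legendre z y :
  expeR (- Lp_legendre p (translate z phi) y)%E = (expR (dotp z y) * dual_weight y)%:E.
Proof.
rewrite Lp_legendre_translate inv_rootE ?inv_root_scale ?mgf_gt0//.
  by rewrite opprK.
by rewrite mule_gt0 ?mgf_gt0// lte_fin expR_gt0.
Qed.

Lemma vol_Lp_legendre z : vol (Lp_legendre p (translate z phi)) = laplace dual_weight z.
Proof. by apply: eq_integral => y _; rewrite expeR_Lp_legendre. Qed.

Lemma Lp_mahler_translate z :
  Lp_mahler p (translate z phi) = (v%:E * laplace dual_weight z)%E.
Proof. by rewrite /Lp_mahler vol_Lp_legendre vol_translate vE. Qed.

Lemma measurable_Lp_legendre z :
  measurable_fun setT (Lp_legendre p (translate z phi)).
Proof.
rewrite (_ : Lp_legendre p (translate z phi) = (fun y =>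
  (p^-1)%:E * lne ((expR (p * - dotp z y))%:E * mgf y))%E); last first.
  by apply/funext => y; exact: Lp_legendre_translate.
apply: measurable_funeM; apply: measurableT_comp; first exact: measurable_lne.
apply: emeasurable_funM; last exact: measurable_mgf.
apply/measurable_EFinP; apply: measurableT_comp => //; apply: measurable_funM => //.
by apply: measurableT_comp => //; exact: measurable_dotp.
Qed.

(** With [c * norm1 x - C <= phi x] and [y] in [cube 0 c], the factor
    [exp (p * (dotp x y - phi x))] is at most [exp (p * C)]. *)
Lemma dual_weight_lower : exists c r, [/\ 0 < c, 0 < r &
  forall y, cube 0 r y -> c <= dual_weight y].
Proof.
have [M [a [r r0 arM]]] := sublevel_cube.
have [|c [C [c0 cC]]] := convex_linear_growth phiNy cphi mphi _ r0 arM.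
  by case: Cphi => _ _ _ /andP[].
exists (expR (- C)), c; split; [exact: expR_gt0|by []|move=> y yc].
rewrite -(inv_root_expR p0) inv_root_le ?mgf_gt0//.
have -> : expR (p * C) = expR (p * C) / v * v by rewrite divfK// gt_eqF.
rewrite EFinM -vE /vol -ge0_integralZl_EFin//.
- apply: ge0_le_integral => //.
  + by move=> x _; rewrite lee_fin mgf_integrand_ge0.
  + by apply/measurable_EFinP; exact: measurable_mgf_integrand.
  + by apply: measurable_funeM; exact: measurable_expeRN.
  + move=> x _; case E : (phi x) => [s| |].
    * rewrite (tilt_fin E)/= -EFinM lee_fin.
      have -> : expR (p * dotp x y) * (expR (- (p * s)) * expR (- s) / v) =
          expR (p * (dotp x y - s)) / v * expR (- s).
        by rewrite mulrBr expRD; ring.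
      rewrite ler_pM2r ?expR_gt0// ler_pM2r ?invr_gt0// ler_expR ler_pM2l//.
      have := cC x; rewrite E lee_fin.
      have := ler_dotp_norm1 x yc; rewrite ler_norml => /andP[_].
      lra.
    * by rewrite (tilt_pinfty E)/= mulr0 mule0.
    * by have := phiNy x; rewrite E.
- by move=> x _; exact: expeR_ge0.
- exact: measurable_expeRN.
- by rewrite divr_ge0 ?expR_ge0// ltW.
Qed.

(** If [phi] is bounded on a cube of radius [r'] around [z], then [dual_weight y] is at
    most a constant times [exp (- (dotp z y + r' / 4 * norm1 y))]; half of this decay
    is left for the exponential moment. *)
Lemma laplace_interior_lty z : interior [set x | (phi x < +oo)%E] z ->
  exists2 rho : R, 0 < rho &
   (\int[lebesgue_rV n]_y (expR (rho * norm1 y) * (expR (dotp z y) * dual_weight y))%:E < +oo)%E.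
Proof.
have [M [a [r r0 arM]]] := sublevel_cube.
move=> /(interior_edom_sublevel phiNy cphi r0 arM)[M' [r' r'0 zM']].
have [k kP] := cube_sublevel_mgf r'0 zM'.
exists (r' / 8); first by rewrite divr_gt0.
apply: (@le_lt_trans _ _ (\int[lebesgue_rV n]_y
   ((expR (- k))%:E * (expR (- (r' / 8) * norm1 y))%:E))%E).
  apply: ge0_le_integral => //.
  - by move=> y _; rewrite lee_fin !mulr_ge0 ?expR_ge0 ?dual_weight_ge0.
  - apply/measurable_EFinP; apply: measurable_funM.
      apply: measurableT_comp => //; apply: measurable_funM => //.
      exact: measurable_norm1.
    exact: (measurable_laplace measurable_dual_weight).
  - apply/measurable_EFinP; apply: measurable_funM => //.
    apply: measurableT_comp => //; apply: measurable_funM => //.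
    exact: measurable_norm1.
  - move=> y _; rewrite -EFinM lee_fin.
    have : dual_weight y <= expR (- (dotp z y + r' / 4 * norm1 y + k)).
      by rewrite -(inv_root_expR p0) inv_root_le ?lte_fin ?expR_gt0.
    move=> /(ler_wpM2l (expR_ge0 (r' / 8 * norm1 y + dotp z y))).
    rewrite expRD -(mulrA (expR _)) => /le_trans; apply.
    by rewrite -!expRD ler_expR le_eqVlt; apply/orP; left; apply/eqP; field.
rewrite ge0_integralZl_EFin//; last first.
  apply/measurable_EFinP; apply: measurableT_comp => //; apply: measurable_funM => //.
  exact: measurable_norm1.
rewrite lte_mul_pinfty//.
by apply: integral_exp_norm1_lty; rewrite divr_gt0.
Qed.

(** Along a supporting direction [th] at [z], the function
    [exp (dotp z y) * dual_weight y] of [y] is nondecreasing.  It is therefore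
    bounded below on all the cubes [cube (k *: (L *: th)) e], which are disjoint for a
    suitable [L]. *)
Lemma laplace_not_interior z : ~ interior [set x | (phi x < +oo)%E] z ->
  laplace dual_weight z = +oo%E.
Proof.
move=> zi.
have [M [a [r r0 arM]]] := sublevel_cube.
have arD : cube a r `<=` [set x | (phi x < +oo)%E].
  by move=> x /arM; exact: sublevel_edom.
have [th th0 thle] := convex_supporting (@convex_edom _ _ _ phiNy cphi) r0 arD zi.
have mono y t : 0 <= t -> expR (- (t * dotp z th)) * dual_weight y <= dual_weight (y + t *: th).
  move=> t0; rewrite -(inv_root_scale p0) ?mgf_gt0//.
  apply: inv_root_le => //; first exact: mgf_gt0.
  rewrite /mgf -ge0_integralZl_EFin//; last 2 first.
  - by move=> x _; rewrite lee_fin mgf_integrand_ge0.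
  - by apply/measurable_EFinP; exact: measurable_mgf_integrand.
  apply: ge0_le_integral => //.
  - by move=> x _; rewrite lee_fin mgf_integrand_ge0.
  - by apply/measurable_EFinP; exact: measurable_mgf_integrand.
  - by apply: measurable_funeM; apply/measurable_EFinP; exact: measurable_mgf_integrand.
  move=> x _; rewrite -EFinM lee_fin.
  have [xoo|] := ltP (phi x) +oo%E; last first.
    by rewrite leye_eq => /eqP/tilt_pinfty ->; rewrite !mulr0.
  rewrite [leRHS]mulrA -expRD ler_wpM2r ?tilt_ge0// ler_expR -mulrDr ler_pM2l//.
  rewrite dotpDr dotpZr [leRHS]addrC lerD2l ler_wpM2l//.
  by have := thle _ xoo; rewrite dotpBl subr_le0.
have [c [e [c0 e0 wc]]] := dual_weight_lower.
have [i thi] : exists i, th ord0 i != 0.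
  apply: contrapT => h; move/negP: th0; apply; apply/eqP/rowP => i; rewrite mxE.
  by apply: contrapT => /eqP thi; apply: h; exists i.
have thi0 : 0 < `|th ord0 i| by rewrite normr_gt0.
(* Consecutive cubes are at distance [2 * e] along coordinate [i]. *)
pose L := 2 * e / `|th ord0 i|.
have L0 : 0 < L by rewrite divr_gt0// mulr_gt0.
pose d := expR (- (e * norm1 z)) * c.
have d0 : 0 < d by rewrite mulr_gt0// expR_gt0.
apply: (@ereal_eq_pinfty _ _ (d * (2 * e) ^+ n)).
  by apply: mulr_gt0 => //; apply: exprn_gt0; rewrite mulr_gt0.
move=> N; apply: (@le_integral_cubes _ _ _ 0 (L *: th) e d N i).
- by apply/measurable_EFinP; exact: (measurable_laplace measurable_dual_weight).
- by move=> y; rewrite lee_fin laplace_integrand_ge0//; exact: dual_weight_ge0.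
- exact: ltW.
- by rewrite mxE normrM gtr0_norm// divfK// gt_eqF.
move=> k x _; rewrite add0r scalerA => xk.
pose y := x - (k%:R * L) *: th.
have ye : cube 0 e y.
  by move=> j; have := xk j; rewrite !mxE subr0.
have t0 : 0 <= k%:R * L by rewrite mulr_ge0// ltW.
rewrite lee_fin -(subrK ((k%:R * L) *: th) x) -/y dotpDr dotpZr expRD.
rewrite -mulrA.
apply: (@le_trans _ _ (expR (dotp z y) * dual_weight y)).
  rewrite /d; apply: ler_pM; rewrite ?expR_ge0 ?(ltW c0)//; last exact: wc.
  rewrite ler_expR; have := ler_dotp_norm1 z ye.
  by rewrite ler_norml => /andP[].
rewrite ler_wpM2l ?expR_ge0//.
by rewrite -ler_pdivrMl ?expR_gt0// -expRN; exact: mono.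
Qed.

End Lp_legendre_laplace.

Section barycenter_laplace.
Context {R : realType} {n : nat} (p : R) (phi : 'rV[R]_n -> \bar R).
Hypothesis p0 : 0 < p.
Hypothesis Cphi : Cvx phi.
Let w := dual_weight p phi.

Lemma laplace_dual_weight_gt0 z : (0 < laplace w z)%E.
Proof.
have [c [r [c0 r0 wc]]] := dual_weight_lower p0 Cphi.
apply: (laplace_gt0 _ _ c0 r0 wc).
  exact: measurable_dual_weight.
exact: dual_weight_ge0.
Qed.

(** The two sides differ by the factor [laplace w z], which normalizes the barycenter;
    the right-hand side is the critical point condition for [laplace w] at [z]. *)
Lemma barycenter_eq0P z :
  (has_barycenter (Lp_legendre p (translate z phi)) /\
   barycenter (Lp_legendre p (translate z phi)) = 0) <->
  ((laplace w z < +oo)%E /\ forall i : 'I_n,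
    (lebesgue_rV n).-integrable setT
      (fun y => (y ord0 i * (expR (dotp z y) * w y))%:E) /\
    (\int[lebesgue_rV n]_y (y ord0 i * (expR (dotp z y) * w y))%:E = 0)%E).
Proof.
set f := Lp_legendre _ _.
have volE : vol f = laplace w z by exact: vol_Lp_legendre.
pose g := fine (laplace w z).
pose J i := (\int[lebesgue_rV n]_y (y ord0 i * (expR (dotp z y) * w y))%:E)%E.
have gE : (laplace w z < +oo)%E -> vol f = g%:E.
  by move=> zoo; rewrite volE fineK// gt0_fin_numE// laplace_dual_weight_gt0.
have g0 : (laplace w z < +oo)%E -> 0 < g.
  by move=> zoo; rewrite -lte_fin -gE// volE laplace_dual_weight_gt0.
have fE i : (laplace w z < +oo)%E ->
    (fun y : 'rV[R]_n => (y ord0 i)%:E * (expeR (- f y) / vol f))%E =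
    (fun y => (g^-1)%:E * (y ord0 i * (expR (dotp z y) * w y))%:E)%E.
  move=> zoo; apply/funext => y.
  rewrite gE// expeR_Lp_legendre// inver gt_eqF ?g0// -!EFinM -/w.
  by congr EFin; ring.
have bE i : (laplace w z < +oo)%E ->
    (lebesgue_rV n).-integrable setT (fun y => (y ord0 i * (expR (dotp z y) * w y))%:E) ->
    (\int[lebesgue_rV n]_y ((y ord0 i)%:E * (expeR (- f y) / vol f)) = (g^-1)%:E * J i)%E.
  by move=> zoo iz; rewrite fE// integralZl.
split=> [[[_ /andP[_ foo] fi] b0]|[zoo zi]].
  rewrite volE in foo; split => // i.
  have iz : (lebesgue_rV n).-integrable setT
      (fun y => (y ord0 i * (expR (dotp z y) * w y))%:E).
    have := fi i; rewrite fE// => /(integrableZl measurableT g).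
    apply: eq_integrable => // y _.
    have gn0 : g != 0 by rewrite gt_eqF// g0.
    by rewrite -EFinM mulVKf.
  split => //.
  have Jfin : J i \is a fin_num by exact: integrable_fin_num.
  have := congr1 (fun b : 'rV[R]_n => b ord0 i) b0.
  rewrite /barycenter !mxE bE// -/(J i) -(fineK Jfin) -EFinM /= => /eqP.
  by rewrite mulf_eq0 invr_eq0 gt_eqF ?g0//= => /eqP ->.
split.
  split.
  - exact: measurable_Lp_legendre.
  - by rewrite volE zoo laplace_dual_weight_gt0.
  - by move=> i; rewrite fE//; apply: integrableZl => //; case: (zi i).
apply/rowP => i; rewrite /barycenter !mxE.
by have [iz z0] := zi i; rewrite bE// /J z0 mule0.
Qed.

End barycenter_laplace.

Theorem proposition1p10 (R : realType) (n : nat) (p : R)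
    (phi : 'rV[R]_n -> \bar R) (p_gt0 : 0 < p) (Cvx_phi : Cvx phi) :
  exists s : 'rV[R]_n,
    [/\ unique (fun z : 'rV[R]_n => Lp_mahler p (translate z phi) =
          ereal_inf (range (fun x : 'rV[R]_n => Lp_mahler p (translate x phi)))) s,
        unique (fun z : 'rV[R]_n =>
          has_barycenter (Lp_legendre p (translate z phi)) /\
          barycenter (Lp_legendre p (translate z phi)) = 0) s
      & interior [set x : 'rV[R]_n | (phi x < +oo)%E] s].
Proof.
pose w := dual_weight p phi.
have [c [r [c0 r0 wc]]] := dual_weight_lower p_gt0 Cvx_phi.
have mw : measurable_fun setT w by exact: measurable_dual_weight.
have w0 y : 0 <= w y by exact: dual_weight_ge0.
have interior_lty z : interior [set x : 'rV[R]_n | (phi x < +oo)%E] z ->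
    (laplace w z < +oo)%E.
  move=> /(laplace_interior_lty p_gt0 Cvx_phi)[rho rho0]; apply: le_lt_trans.
  apply: ge0_le_integral => //.
  - by move=> y _; rewrite lee_fin laplace_integrand_ge0.
  - by apply/measurable_EFinP; exact: measurable_laplace.
  - apply/measurable_EFinP; apply: measurable_funM; last exact: measurable_laplace.
    apply: measurableT_comp => //; apply: measurable_funM => //; exact: measurable_norm1.
  - move=> y _; rewrite lee_fin ler_peMl ?laplace_integrand_ge0// expR_ge1//.
    by rewrite mulr_ge0 ?norm1_ge0// ltW.
have [M [a [e e0 aeM]]] := sublevel_cube Cvx_phi.
have ai : interior [set x : 'rV[R]_n | (phi x < +oo)%E] a.
  by apply/nbhs_cubeP; exists e => // x /aeM; exact: sublevel_edom.
have [s soo smin] := laplace_minimizer_exists mw w0 c0 r0 wc (interior_lty _ ai).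
have si : interior [set x : 'rV[R]_n | (phi x < +oo)%E] s.
  by apply: contrapT => /(laplace_not_interior p_gt0 Cvx_phi) h; move: soo; rewrite h.
have suniq z : laplace w z = laplace w s -> s = z.
  by move=> zs; exact: (laplace_minimizer_unique mw w0 c0 r0 wc soo zs smin).
pose v := fine (vol phi).
have v0 : 0 < v.
  by case: Cvx_phi => _ _ _ /andP[V0 Voo]; rewrite fine_gt0// V0.
have infE : ereal_inf (range (fun x : 'rV[R]_n => Lp_mahler p (translate x phi))) =
    (v%:E * laplace w s)%E.
  apply/eqP; rewrite eq_le; apply/andP; split.
    by apply: ereal_inf_lbound; exists s => //; rewrite Lp_mahler_translate.
  apply: le_ereal_inf_tmp => _ [x _ <-].
  by rewrite Lp_mahler_translate// lee_pmul2l// ?lte_fin.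
exists s; split => //; split.
- by rewrite infE Lp_mahler_translate.
- move=> z; rewrite infE Lp_mahler_translate// => /eqP; rewrite eq_le !lee_pmul2l// ?lte_fin//.
  by rewrite -eq_le => /eqP /suniq.
- apply/(barycenter_eq0P p_gt0 Cvx_phi); split => //.
  have [rho rho0 soo'] := laplace_interior_lty p_gt0 Cvx_phi si.
  exact: (laplace_minimizer_critical mw w0 rho0 soo' smin).
- move=> z /(barycenter_eq0P p_gt0 Cvx_phi)[zoo zi]; apply: suniq; apply/eqP.
  rewrite eq_le smin andbT.
  by apply: (laplace_critical_minimizer mw w0 zoo) => i; case: (zi i).
Qed.
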